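(* Let $\mathcal T^1$ be the circle and let $F_0:[0,1]\times\mathcal T^1\to[0,1]\times\mathcal T^1$, $F_0(x,y)=(T_0(x),G_0(x,y))$, with $T_0(x)=2x\bmod 1$ and $G_0(x,y)=y+\theta\varphi(x)$, where $\varphi=1_{[0,\frac12]}$ and $\theta$ is a well approximable Diophantine irrational with linear Diophantine type $\gamma_l(\theta)>2$. Let $\mu_0$ be the Lebesgue measure on $[0,1]\times\mathcal T^1$. For every $\gamma<\gamma_l(\theta)$ there is a sequence of reals $\delta_j\ge0$, $\delta_j\to0$, and a sequence of maps $\hat F_{\delta_j}(x,y)=(T_0(x),\hat G_{\delta_j}(x,y))$ satisfying conditions (A1)–(A3) (uniformly in $j$) and (D1), (D2) of the context, such that $$\|\mu_0-\mu_j\|_{''1''}\ \ge\ \frac19\,\delta_j^{\frac1{\gamma-1}}$$ holds for every $j$ and every Borel probability measure $\mu_j$ that is invariant for $\hat F_{\delta_j}$ and has absolutely continuous projection on $[0,1]$.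
   Context: **Diophantine type.** $\|\cdot\|$ is the distance to the nearest integer. $\gamma_l(\theta)=\inf\{\gamma:\exists c_0>0\text{ s.t. }\|k\theta\|\ge c_0|k|^{-\gamma}\ \forall\,0\ne k\in\mathbb Z\}$; ''Diophantine'' means that this is finite. **Norm.** $m$ is Lebesgue measure on $[0,1]$, $M=\mathcal T^1$, $X=[0,1]\times M$, $\pi_x(x,y)=x$, $B(x,r)$ is the ball in $[0,1]$. For a finite signed Borel measure $\nu$ on $M$, $\|\nu\|_{W_1}=\sup\{|\int g\,d\nu| : \mathrm{Lip}(g)\le1,\ \|g\|_\infty\le1\}$. For a positive Borel measure $\mu$ on $X$ whose projection on $[0,1]$ is absolutely continuous with density $\phi_\mu$, with disintegration $\{\mu_s\}_{s\in[0,1]}$ into probability measures on the leaves $\{s\}\times M$, $\mu|_s$ is the measure on $M$ equal to $\phi_\mu(s)$ times the image of $\mu_s$ under $(s,y)\mapsto y$. For a signed $\mu=\mu^+-\mu^-$ (Jordan decomposition) with both projections absolutely continuous, $\mu|_s=\mu^+|_s-\mu^-|_s$, and $\|\mu\|_{''1''}=\int_{[0,1]}\|\mu|_s\|_{W_1}\,dm(s)$. **Conditions (A1)–(A3), uniformly**, for a family of skew products $F_j(x,y)=(T_j(x),G_j(x,y))$: there are constants $\lambda<1$, $C_h\ge0$, $\alpha\in\mathbb R$ with $\lambda\alpha<1$, $B_T$, $\hat H<\infty$ and $A>0$, independent of $j$, such that for every $j$: (A1) $T_j$ has finitely many branches $T_{j,i}$, onto and $C^2$, with $\inf T_j'\ge1/\lambda$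 and $\frac{1}{|T_{j,i}'\circ T_{j,i}^{-1}(s_2)|}-\frac1{|T_{j,i}'\circ T_{j,i}^{-1}(s_1)|}\le C_h|s_1-s_2|$ for all $s_1,s_2\in[0,1]$, and the transfer operator of $T_j$ on densities satisfies $\|L_{T_j}^n\phi\|_{BV}\le A_T\lambda^n\|\phi\|_{BV}+B_T\|\phi\|_1$ for some $A_T$ and all $n$, where $\|\phi\|_{BV}=\|\phi\|_1+\sup_{r\le A}\frac1r\int\operatorname{ess\,sup}_{x_1,x_2\in B(x,r)}|\phi(x_1)-\phi(x_2)|\,dx$; (A2) $|G_j(x,y_1)-G_j(x,y_2)|\le\alpha|y_1-y_2|$ for all $x,y_1,y_2$; (A3) $\sup_{r\le A}\frac1r\int_{[0,1]}\sup_{y\in M,\,x_1,x_2\in B(x,r)}|G_j(x_1,y)-G_j(x_2,y)|\,dx\le\hat H$. **Conditions (D1), (D2)** for $\hat F_{\delta_j}$: (D1) the base map of $\hat F_{\delta_j}$ has the form $T_0\circ\sigma$ for some diffeomorphism $\sigma$ with $\|\sigma-Id\|_\infty\le\delta_j$ and $\|\frac1{\sigma'}-1\|_\infty\le\delta_j$ (here the base map is $T_0$ itself, so this holds with $\sigma=Id$); (D2) $|G_0(x,y)-\hat G_{\delta_j}(x,y)|\le\delta_j$ for all $x\in[0,1]$, $y\in\mathcal T^1$.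
   Formalization: The claim is proved for 1 < γ < γ_l(θ) rather than every γ < γ_l(θ): at γ = 1 the exponent 1/(γ−1) is undefined, and for γ < 1 it is negative, so the lower bound tends to infinity while the norm is at most 2. *)

(* Defs.v *)
From HB Require Import structures.
From mathcomp Require Import all_boot all_order all_algebra.
From mathcomp Require Import all_classical all_reals all_analysis.
From mathcomp Require Import measurable_realfun ess_sup_inf.

Set Implicit Arguments.
Unset Strict Implicit.
Unset Printing Implicit Defensive.

Import Order.TTheory GRing.Theory Num.Theory.
Import numFieldNormedType.Exports.

Local Open Scope ring_scope.
Local Open Scope classical_set_scope.

(** * Linear Diophantine type *)

Section arithmetic.
Context {R : realType}.
Implicit Types x theta : R.

Definition dist_int x : R := inf [set `|x - k%:~R| | k in [set: int]].

Definition frac x : R := x - (Num.floor x)%:~R.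

Lemma frac_itv x : 0 <= frac x < 1.
Proof.
by rewrite /frac subr_ge0 floor_le ltrBlDr -(intrD _ 1) addrC floorD1_gt.
Qed.

Lemma measurable_frac : measurable_fun [set: R] frac.
Proof.
apply: measurable_funB => //.
apply: nondecreasing_measurable => // x y xy.
by rewrite ler_int le_floor.
Qed.

(* +oo when no exponent works, i.e. when theta is not Diophantine. *)
Definition lin_type theta : \bar R :=
  ereal_inf [set gamma%:E | gamma in [set gamma : R |
    exists2 c0 : R, 0 < c0 &
      forall k : int, k != 0 ->
        c0 * `|k%:~R| `^ (- gamma) <= dist_int (k%:~R * theta)]].

End arithmetic.

(** * The circle *)

(* R/Z, each class being represented by its representative in [0, 1[. The
   Borel sets of R/Z are then the traces on [0, 1[ of the Borel sets of R. *)
Record circle (R : realType) := Circle {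
  circle_val : R ; circle_valP : 0 <= circle_val < 1 }.

HB.instance Definition _ (R : realType) := [isSub for @circle_val R].
HB.instance Definition _ (R : realType) := [Choice of circle R by <:].

Definition to_circle {R : realType} (t : measurableTypeR R) : circle R :=
  Circle (frac_itv t).

HB.instance Definition _ (R : realType) :=
  isPointed.Build (circle R) (to_circle 0).

HB.instance Definition _ (R : realType) :=
  Measurable.copy (circle R)
    (g_sigma_algebra_preimageType (@circle_val R)).

Lemma measurable_to_circle (R : realType) :
  measurable_fun [set: measurableTypeR R] (@to_circle R).
Proof.
move=> _ _ [B mB <-]; rewrite setTI.
by apply: (measurable_frac measurableT mB).
Qed.

HB.instance Definition _ (R : realType) :=
  isMeasurableFun.Build _ _ _ _ (@to_circle R) (@measurable_to_circle R).

Section circle.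
Context {R : realType}.
Implicit Types y z : circle R.

Definition circle_dist y z : R := dist_int (circle_val y - circle_val z).

Definition rotate y (t : R) : circle R := to_circle (circle_val y + t).

End circle.

(** * Slices of a measure on [0, 1] x circle and the "1" norm *)

(* Measures on [0, 1] x circle are measures on R * circle that do not charge
   the complement of [0, 1] x circle. *)

Section norm.
Context {R : realType}.
Local Notation XT := (measurableTypeR R * circle R)%type.
Local Open Scope ereal_scope.

Section jordan.
Context d (T : measurableType d).
Variable nu : {charge set T -> \bar R}.

Let P := sval (cid (Hahn_decomposition nu)).
Let N := sval (cid (svalP (cid (Hahn_decomposition nu)))).
Let nuPN : hahn_decomposition nu P N :=
  svalP (cid (svalP (cid (Hahn_decomposition nu)))).

Definition pos_part : {finite_measure set T -> \bar R} := jordan_pos nuPN.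
Definition neg_part : {finite_measure set T -> \bar R} := jordan_neg nuPN.

Definition charge_integral (g : T -> R) : R :=
  (Rintegral pos_part setT g - Rintegral neg_part setT g)%R.

End jordan.

Definition csub d (T : measurableType d)
    (mu nu : {charge set T -> \bar R}) : {charge set T -> \bar R} :=
  cadd mu (copp nu).

Definition W1_norm (nu : {charge set (circle R) -> \bar R}) : \bar R :=
  ereal_sup [set `|charge_integral nu g|%:E | g in [set g : circle R -> R |
    (forall y z, `|g y - g z| <= circle_dist y z)%R /\
    (forall y, `|g y| <= 1)%R]].

(* phi is the density of the projection of mu on [0, 1] and kappa s is the
   image on the circle of the conditional probability on {s} x circle. *)
Definition disintegration (mu : {measure set XT -> \bar R})
    (phi : R -> R) (kappa : R -> probability (circle R) R) : Prop :=
  [/\ measurable_fun setT phi,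
      forall s, (0 <= phi s)%R,
      forall A, measurable A ->
        mu (A `*` setT) =
        \int[lebesgue_measure]_(s in `[0%R, 1%R] `&` A) (phi s)%:E,
      forall B, measurable B -> measurable_fun setT (fun s => kappa s B) &
      forall E, measurable E ->
        mu E = \int[lebesgue_measure]_(s in `[0%R, 1%R])
                 (kappa s (xsection E s) * (phi s)%:E)].

Definition slice (phi : R -> R) (kappa : R -> probability (circle R) R)
    (s : R) : {charge set (circle R) -> \bar R} :=
  cscale (phi s) (charge_of_finite_measure (kappa s)).

(* When both parts of nu have an absolutely continuous projection, their
   disintegrations exist and are almost everywhere unique, so that the set
   below is a singleton. *)
Definition one_norm (nu : {charge set XT -> \bar R}) : \bar R :=
  ereal_inf [set r : \bar R | exists phip kappap phin kappan,
    [/\ disintegration (pos_part nu) phip kappap,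
        disintegration (neg_part nu) phin kappan &
        r = \int[lebesgue_measure]_(s in `[0%R, 1%R])
              W1_norm (csub (slice phip kappap s) (slice phin kappan s))]].

Definition circle_lebesgue : probability (circle R) R :=
  distribution (uniform_prob (@ltr01 R)) (@to_circle R).

(* uniform_prob (@ltr01 R) is the Lebesgue measure restricted to [0, 1]. *)
Definition lebesgue_X : probability XT R :=
  (uniform_prob (@ltr01 R) \x circle_lebesgue)%E.

End norm.

(** * Skew products *)

Section skew.
Context {R : realType}.
Local Notation XT := (measurableTypeR R * circle R)%type.
Implicit Types (T : R -> R) (G : R -> circle R -> circle R).

Local Notation m := (@lebesgue_measure R).

Definition phase_space : set XT := `[0, 1] `*` setT.

Definition skew_product T G (p : XT) : XT := (T p.1, G p.1 p.2).

Definition invariant_measure (F : XT -> XT)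
    (mu : set XT -> \bar R) : Prop :=
  forall A, measurable A -> mu (phase_space `&` F @^-1` A) = mu A.

Definition doubling : R -> R := fun x => frac (2 * x).

Definition rotation_skew (theta : R) : R -> circle R -> circle R :=
  fun x y => rotate y (theta * \1_(`[0, 2^-1] : set R) x).

Definition ball01 (x r : R) : set R := ball x r `&` `[0, 1].

Definition L1_norm (phi : R -> R) : \bar R :=
  (\int[m]_(x in `[0%R, 1%R]) `|phi x|%:E)%E.

(* The oscillation being nonnegative, extending it by 0 off ball01 x r does
   not change its essential supremum. *)
Definition ess_osc (phi : R -> R) (x r : R) : \bar R :=
  ess_sup (m \x m)%E
    ((fun p => `|phi p.1 - phi p.2|%:E) \_ (ball01 x r `*` ball01 x r)).

Definition BV_norm (A : R) (phi : R -> R) : \bar R :=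
  (L1_norm phi + ereal_sup [set r^-1%:E * \int[m]_(x in `[0%R, 1%R])
                                 ess_osc phi x r
                           | r in `]0%R, A] : set R])%E.

(* psi is the density of the image under T of the measure phi dm. *)
Definition is_transfer T (phi psi : R -> R) : Prop :=
  m.-integrable `[0, 1] (EFin \o psi) /\
  forall A : set (measurableTypeR R), measurable A ->
    (\int[m]_(x in `[0%R, 1%R] `&` A) (psi x)%:E =
     \int[m]_(x in `[0%R, 1%R] `&` T @^-1` A) (phi x)%:E)%E.

(* Densities being determined almost everywhere, the choice of a
   representative is immaterial. *)
Definition transfer T (phi : R -> R) : R -> R := get (is_transfer T phi).

(* A function is C^2 on [a, b] when it is the restriction of a C^2 function on
   R; the branch on [c i, c i.+1] is given through such an extension b i. *)
Definition full_branches (lambda Ch : R) T : Prop :=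
  exists (n : nat) (c : nat -> R) (b : nat -> R -> R),
    [/\ c 0%N = 0, c n = 1, (forall i, (i < n)%N -> c i < c i.+1) &
      forall i, (i < n)%N ->
      [/\ forall x, c i < x < c i.+1 -> T x = b i x,
          [/\ forall x, derivable (b i) x 1,
              forall x, derivable (derive1 (b i)) x 1 &
              continuous (derive1 (derive1 (b i)))],
          b i @` `[c i, c i.+1] = `[0, 1],
          forall x, c i <= x <= c i.+1 -> lambda^-1 <= derive1 (b i) x &
          forall x1 x2 s1 s2, c i <= x1 <= c i.+1 -> c i <= x2 <= c i.+1 ->
            b i x1 = s1 -> b i x2 = s2 ->
            `|derive1 (b i) x2|^-1 - `|derive1 (b i) x1|^-1 <=
              Ch * `|s1 - s2| ]].

Definition lasota_yorke (lambda BT A : R) T : Prop :=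
  exists AT : R, forall (phi : R -> R) (n : nat),
    m.-integrable `[0, 1] (EFin \o phi) ->
    (BV_norm A phi < +oo)%E ->
    (BV_norm A (iter n (transfer T) phi) <=
       (AT * lambda ^+ n)%:E * BV_norm A phi + BT%:E * L1_norm phi)%E.

Definition condA1 (lambda Ch BT A : R) T : Prop :=
  [/\ forall x, 0 <= x <= 1 -> 0 <= T x <= 1,
      full_branches lambda Ch T &
      lasota_yorke lambda BT A T].

Definition condA2 (alpha : R) G : Prop :=
  forall x y1 y2, 0 <= x <= 1 ->
    circle_dist (G x y1) (G x y2) <= alpha * circle_dist y1 y2.

Definition osc_G G (x r : R) : \bar R :=
  ereal_sup [set e | exists y x1 x2,
    [/\ ball01 x r x1, ball01 x r x2 &
        e = (circle_dist (G x1 y) (G x2 y))%:E]].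

Definition condA3 (A H : R) G : Prop :=
  (ereal_sup [set r^-1%:E * \int[m]_(x in `[0%R, 1%R]) osc_G G x r
             | r in `]0%R, A] : set R] <= H%:E)%E.

Definition uniform_condA (T : nat -> R -> R)
    (G : nat -> R -> circle R -> circle R) : Prop :=
  exists lambda Ch alpha BT H A : R,
    [/\ 0 < lambda < 1, 0 <= Ch, lambda * alpha < 1, 0 < A &
        forall j, [/\ condA1 lambda Ch BT A (T j), condA2 alpha (G j) &
                      condA3 A H (G j)]].

Definition diffeo01 (sigma : R -> R) : Prop :=
  [/\ forall x, derivable sigma x 1, continuous (derive1 sigma),
      set_bij `[0, 1] `[0, 1] sigma &
      forall x, 0 <= x <= 1 -> derive1 sigma x != 0].

Definition condD1 (T0 That : R -> R) (delta : R) : Prop :=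
  exists sigma : R -> R,
    [/\ diffeo01 sigma,
        forall x, 0 <= x <= 1 -> That x = T0 (sigma x),
        forall x, 0 <= x <= 1 -> `|sigma x - x| <= delta &
        forall x, 0 <= x <= 1 -> `|(derive1 sigma x)^-1 - 1| <= delta].

Definition condD2 (G0 Ghat : R -> circle R -> circle R) (delta : R) : Prop :=
  forall x y, 0 <= x <= 1 -> circle_dist (G0 x y) (Ghat x y) <= delta.

End skew.

(* Main.v *)
(* Pick p / k with |k theta - p| <= k^-gamma. Replacing theta by p / k alone is
   not enough, because mu_0 remains invariant; so the fibre map is also composed
   with the pinching y |-> y - c ||k y||, which fixes the lattice (1/k) Z / Z and
   pushes every other point down towards it. Since rotations by multiples of
   1 / k preserve the fractional part of k y, the latter is a strict Lyapunov
   function off the lattice, and every invariant probability gives full measure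
   to the lattice. The 1-Lipschitz function ||k y|| / k vanishes there, while its
   mean under mu_0 is at least 1 / (8 k); this bounds the distance from below,
   and delta <= k^-gamma gives delta^(1 / (gamma - 1)) <= 1 / k. *)

Require Import Defs.
From HB Require Import structures.
From mathcomp Require Import all_boot all_order all_algebra.
From mathcomp Require Import all_classical all_reals all_analysis.
From mathcomp Require Import measurable_realfun ess_sup_inf.
From mathcomp Require Import ring lra.

Set Implicit Arguments.
Unset Strict Implicit.
Unset Printing Implicit Defensive.

Import Order.TTheory GRing.Theory Num.Theory.
Import numFieldNormedType.Exports.

Local Open Scope ring_scope.
Local Open Scope classical_set_scope.

(** Two features of the definitions shape the norm estimate. [one_norm] is an infimum over all
    disintegrations of the Jordan parts of mu_0 - mu_j, and these parts come from an arbitrarily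
    chosen Hahn decomposition. A nonnegative test function g that vanishes mu_j-almost everywhere
    settles both points: above {g > 0} the difference is just mu_0, which is positive, so its parts
    are known there whatever the choices. Since gamma lies below the infimum [lin_type], the
    inequality with exponent gamma fails for every constant c0. Taking c0 = 1 / (2 (j + 1)) makes
    delta_j tend to 0 without any knowledge of the growth of the denominators k. Half of delta_j
    pays for replacing theta by p / k, the other half is the pinching strength c. Then c k <= 1 / 2,
    which keeps the fibre Lipschitz constant at 3 / 2 < 2 and prevents the pinching from pushing a
    point past the lattice. The size of c does not enter the lower bound: any positive c puts the
    whole invariant measure on the lattice. *)

(** * Distance to the nearest integer *)

(* fraction.frac would otherwise shadow the fractional part of Defs. *)
Local Notation frac := Defs.frac.

Section dist_int.
Context {R : realType}.
Implicit Types (x y : R) (k : int).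

Lemma dist_int_le x k : dist_int x <= `|x - k%:~R|.
Proof. by apply: ge_inf; [exists 0 => _ [z _ <-] | exists k]. Qed.

Lemma dist_int_lb x r : (forall k, r <= `|x - k%:~R|) -> r <= dist_int x.
Proof.
move=> h; apply: lb_le_inf; first by exists `|x - 0%:~R|, 0.
by move=> _ [k _ <-].
Qed.

Lemma dist_int_ge0 x : 0 <= dist_int x.
Proof. by apply: dist_int_lb. Qed.

Lemma dist_int_lt_ex x r : dist_int x < r -> exists k, `|x - k%:~R| < r.
Proof.
by move=> /inf_lt[|_ [k _ <-] kr]; [exists `|x - 0%:~R|, 0 | exists k].
Qed.

Lemma dist_int_norm x : dist_int x <= `|x|.
Proof. by have := dist_int_le x 0; rewrite subr0. Qed.

Lemma dist_intD x y : dist_int (x + y) <= dist_int x + dist_int y.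
Proof.
rewrite -lerBlDr; apply: dist_int_lb => k; rewrite lerBlDl -lerBlDr.
apply: dist_int_lb => l; rewrite lerBlDl.
apply: le_trans (dist_int_le _ (k + l)) _.
rewrite intrD; apply: le_trans (ler_normD _ _).
by rewrite le_eqVlt; apply/orP; left; apply/eqP; congr `|_|; ring.
Qed.

Lemma dist_intDz x k : dist_int (x + k%:~R) = dist_int x.
Proof.
have h (z : R) (l : int) : dist_int (z + l%:~R) <= dist_int z.
  apply: dist_int_lb => i; apply: le_trans (dist_int_le _ (i + l)) _.
  by rewrite intrD opprD addrACA subrr addr0.
apply/le_anti; rewrite h/=.
by have := h (x + k%:~R) (- k); rewrite intrN addrK.
Qed.

Lemma dist_intN x : dist_int (- x) = dist_int x.
Proof.
have h (z : R) : dist_int (- z) <= dist_int z.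
  apply: dist_int_lb => i; apply: le_trans (dist_int_le _ (- i)) _.
  by rewrite intrN -opprD normrN.
by apply/le_anti; rewrite h/= -{1}(opprK x) h.
Qed.

Lemma dist_intB x y : `|dist_int x - dist_int y| <= dist_int (x - y).
Proof.
rewrite ler_norml lerBrDr addrC -lerBrDr opprK addrC; apply/andP; split.
  have := dist_intD (- (x - y)) x; rewrite dist_intN opprB subrK; lra.
have := dist_intD (x - y) y; rewrite subrK; lra.
Qed.

(** Multiplication by k maps integers to integers, so each integer near x yields one near k x. This
    gives y |-> ||k y|| its Lipschitz constant |k|. *)
Lemma dist_intMz x k : dist_int (k%:~R * x) <= `|k%:~R| * dist_int x.
Proof.
have [->|k0] := eqVneq k 0.
  by rewrite mul0r normr0 mul0r; have := dist_int_norm (0 : R); rewrite normr0.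
rewrite -ler_pdivrMl ?normr_gt0 ?intr_eq0//; apply: dist_int_lb => i.
rewrite ler_pdivrMl ?normr_gt0 ?intr_eq0// -normrM mulrBr -intrM.
exact: dist_int_le.
Qed.

Lemma dist_int_frac x : dist_int (frac x) = dist_int x.
Proof. by rewrite /frac -intrN dist_intDz. Qed.

Lemma fracDz x k : frac (x + k%:~R) = frac x.
Proof.
rewrite /frac floorDrz ?intrKfloor ?rpred_int// intrD.
ring.
Qed.

Lemma frac_id x : 0 <= x < 1 -> frac x = x.
Proof. by move=> h; rewrite /frac (floor_def (m := 0)) ?subr0// add0r. Qed.

Lemma frac_fracD x y : frac (frac x + y) = frac (x + y).
Proof.
by rewrite {2}/frac -[in LHS]intrN addrAC fracDz.
Qed.

(** For an integer k, the class of k x modulo 1 depends only on the class of x: expressions in k y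
    make sense on the circle and are unaffected by the choice of representative. *)
Lemma frac_intfrac x k : frac (k%:~R * frac x) = frac (k%:~R * x).
Proof. by rewrite {2}/frac mulrBr -intrM -intrN fracDz. Qed.

Lemma dist_int_intfrac x k : dist_int (k%:~R * frac x) = dist_int (k%:~R * x).
Proof. by rewrite -[LHS]dist_int_frac frac_intfrac dist_int_frac. Qed.

Lemma dist_int_fracB x y : dist_int (frac x - frac y) = dist_int (x - y).
Proof.
rewrite -(dist_intDz (x - y) (Num.floor y - Num.floor x)) intrB /frac.
by congr dist_int; ring.
Qed.

Lemma dist_int_le_frac x : dist_int x <= frac x.
Proof.
rewrite -dist_int_frac; apply: le_trans (dist_int_norm _) _.
by rewrite ger0_norm //; case/andP: (frac_itv x).
Qed.

Lemma dist_int_le_fracC x : dist_int x <= 1 - frac x.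
Proof.
have /andP[h0 h1] := frac_itv x.
rewrite -dist_int_frac; apply: le_trans (dist_int_le _ 1) _.
rewrite distrC ger0_norm; lra.
Qed.

Lemma dist_int_min x : dist_int x = Num.min (frac x) (1 - frac x).
Proof.
apply/le_anti; rewrite le_min dist_int_le_frac dist_int_le_fracC/=.
have /andP[h0 h1] := frac_itv x.
rewrite -dist_int_frac; apply: dist_int_lb => k.
(* No integer lies strictly between 0 and 1: those at most 0 are at distance at least [frac x],
   those at least 1 at distance at least [1 - frac x]. *)
have [k0|k1] := lerP k 0.
  have k0' : (k%:~R : R) <= 0 by rewrite lerz0.
  rewrite ge_min ger0_norm; lra.
have k1' : 1 <= (k%:~R : R) by rewrite ler1z.
rewrite ge_min distrC [in X in _ || X]ger0_norm; lra.
Qed.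

Lemma dist_int_le_half x : dist_int x <= 2^-1.
Proof. have := dist_int_le_frac x; have := dist_int_le_fracC x; lra. Qed.

(** This symmetry of the tent function gives a lower bound for its mean by averaging over a
    half-period shift, without integrating the tent itself. *)
Lemma dist_int_half x : dist_int (x + 2^-1) = 2^-1 - dist_int x.
Proof.
have /andP[h0 h1] := frac_itv x.
have -> : dist_int (x + 2^-1) = dist_int (frac x + 2^-1).
  by rewrite -[LHS]dist_int_frac -frac_fracD dist_int_frac.
have [h|h] := lerP (2^-1) (frac x).
  rewrite -(dist_intDz _ (-1)) !dist_int_min (@frac_id (_ + _)); last by lra.
  rewrite minElt minElt; case: ifPn; case: ifPn; lra.
rewrite !dist_int_min (@frac_id (_ + _)); last by lra.
rewrite minElt minElt; case: ifPn; case: ifPn; lra.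
Qed.

Lemma measurable_dist_int : measurable_fun [set: R] (@dist_int R).
Proof.
rewrite (_ : @dist_int R = (@frac R \min (cst 1 \- @frac R))); last first.
  by apply/funext => x; rewrite /= dist_int_min.
apply: measurable_minr; first exact: measurable_frac.
by apply: measurable_funB => //; exact: measurable_frac.
Qed.

End dist_int.

(** * Pinched rotations of the fibre *)

Section monotonicity.
Context d (T : measurableType d) (R : realType).
Variable mu : {measure set T -> \bar R}.
Local Open Scope ereal_scope.

(* The library version requires both functions to be measurable, which is not
   known for the oscillation of a fibre map or for the norms of the slices. *)
Import HBNNSimple.

Lemma ge0_le_integral_nonmeasurable (D : set T) (f g : T -> \bar R) :
  (forall x, D x -> 0 <= f x) -> (forall x, D x -> f x <= g x) ->
  \int[mu]_(x in D) f x <= \int[mu]_(x in D) g x.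
Proof.
move=> f0 fg; have g0 x : D x -> 0 <= g x.
  by move=> Dx; exact: le_trans (f0 _ Dx) (fg _ Dx).
(* Both integrals are suprema over simple functions below the integrand, and a simple function below
   f is also below g. *)
rewrite !ge0_integralE //= ge_ereal_sup// => _ [h/= hf <-].
apply: le_ereal_sup_tmp; exists (sintegral mu h) => //; exists h => //= x.
apply: le_trans (hf x) _; rewrite !patchE; case: ifPn => // /[!inE] Dx.
exact: fg.
Qed.

End monotonicity.

Section fibre_map.
Context {R : realType}.
Local Notation XT := (measurableTypeR R * circle R)%type.
Local Notation m := (@lebesgue_measure R).
Implicit Types (x : R) (y z : circle R).

Lemma circle_dist_rotate y z (s t : R) :
  circle_dist (rotate y s) (rotate z t) =
  dist_int (circle_val y - circle_val z + (s - t)).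
Proof.
by rewrite /circle_dist /= dist_int_fracB; congr dist_int; ring.
Qed.

Variables (k p : int) (c : R).

(* The factor y |-> y - c ||k y|| has Lipschitz constant at most 1 + c |k|, so
   that c |k| <= 1 / 2 keeps condition (A2) with alpha = 3 / 2. *)
Definition pinched_rotation x y : circle R :=
  rotate y (p%:~R / k%:~R * \1_(`[0, 2^-1] : set R) x
            - c * dist_int (k%:~R * circle_val y)).

Lemma measurable_circle_val : measurable_fun [set: circle R] (@circle_val R).
Proof.
move=> _ B mB; rewrite setTI; exists B => //.
by rewrite setTI.
Qed.

Lemma measurable_doubling : measurable_fun [set: R] (@doubling R).
Proof.
apply: (measurableT_comp measurable_frac).
exact: measurable_funM.
Qed.

Lemma measurable_dist_int_circle :
  measurable_fun [set: circle R] (fun y => dist_int (k%:~R * circle_val y)).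
Proof.
apply: (measurableT_comp measurable_dist_int).
by apply: measurable_funM => //; exact: measurable_circle_val.
Qed.

Lemma measurable_pinched_skew :
  measurable_fun [set: XT] (skew_product (@doubling R) pinched_rotation).
Proof.
apply/measurable_fun_pairP; split => /=.
  exact: (measurableT_comp measurable_doubling).
apply: (measurableT_comp (@measurable_to_circle R)).
apply: measurable_funD.
  exact: (measurableT_comp measurable_circle_val).
apply: measurable_funB.
  apply: measurable_funM => //.
  have mI : measurable_fun setT
      (\1_(`[0, 2^-1] : set (measurableTypeR R)) : measurableTypeR R -> R).
    exact: measurable_indic.
  exact: (measurableT_comp mI).
apply: measurable_funM => //.
exact: (measurableT_comp measurable_dist_int_circle).
Qed.

Hypothesis c_ge0 : 0 <= c.
Hypothesis ck : c * `|k%:~R| <= 2^-1.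

Lemma pinched_rotation_A2 : condA2 (3 / 2) pinched_rotation.
Proof.
move=> x y z _; rewrite circle_dist_rotate.
set a := circle_val y; set b := circle_val z.
rewrite [X in dist_int X](_ : _ = a - b +
  c * (dist_int (k%:~R * b) - dist_int (k%:~R * a))); last by ring.
apply: le_trans (dist_intD _ _) _; rewrite -/(circle_dist y z).
have h : `|dist_int (k%:~R * b) - dist_int (k%:~R * a)|
    <= `|k%:~R| * circle_dist y z.
  by rewrite distrC (le_trans (dist_intB _ _))// -mulrBr dist_intMz.
have d0 : 0 <= circle_dist y z := dist_int_ge0 _.
have : `|c * (dist_int (k%:~R * b) - dist_int (k%:~R * a))|
    <= 2^-1 * circle_dist y z.
  rewrite normrM (ger0_norm c_ge0); apply: le_trans (ler_wpM2l c_ge0 h) _.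
  by rewrite mulrA ler_wpM2r.
move/(le_trans (dist_int_norm _)); lra.
Qed.

(** The first coordinate enters only through the jump of the indicator at 1 / 2; the one at 0 is not
    seen because [ball01] is cut at [0, 1]. If the jump is at distance at least r from x, both
    points lie on the same side of it; otherwise distances on the circle are at most 1 / 2. *)
Lemma osc_pinched_rotation x r : 0 <= x <= 1 ->
  (osc_G pinched_rotation x r <= (\1_(ball (2^-1 : R) r) x)%:E)%E.
Proof.
move=> /andP[x0 x1]; apply: ge_ereal_sup =>
  _ [y [x1' [x2 [[h1 i1] [h2 i2] ->]]]].
rewrite lee_fin indicE.
have [|/negP h] := boolP (x \in (ball (2^-1 : R) r : set R)).
  by move=> _; apply: le_trans (dist_int_le_half _) _;
    rewrite /= invf_le1 ?ler1n.
have {}h : r <= `|2^-1 - x|.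
  by rewrite leNgt; apply/negP => h'; apply: h; rewrite inE /ball /= /ball_.
move: h1 h2 i1 i2; rewrite /ball /= !in_itv /=.
rewrite !ltr_norml => /andP[a1 a2] /andP[b1 b2] /andP[e1 e2] /andP[f1 f2].
rewrite circle_dist_rotate subrr add0r opprB addrACA addrA.
suff -> : \1_(`[0, 2^-1] : set R) x1' = \1_(`[0, 2^-1] : set R) x2 :> R.
  rewrite [X in dist_int X](_ : _ = 0); last by ring.
  by rewrite (le_trans (dist_int_norm _))// normr0.
rewrite !indicE !mem_setE !in_itv /= e1 f1 /=.
move: h; rewrite ler_normr => /orP[] h.
  by congr (_%:R); congr nat_of_bool; apply/idP/idP => _; lra.
by congr (_%:R); congr nat_of_bool; apply/idP/idP; lra.
Qed.

(** The bound 2 is the length 2 r of the ball around the jump, divided by r. *)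
Lemma pinched_rotation_A3 : condA3 1 2 pinched_rotation.
Proof.
apply: ge_ereal_sup => _ [r /= + <-]; rewrite in_itv /= => /andP[r0 r1].
rewrite -lee_pdivlMl ?invr_gt0//.
apply: (@le_trans _ _
  (\int[m]_(x in `[0%R, 1%R]) (\1_(ball (2^-1 : R) r) x)%:E)%E).
  apply: ge0_le_integral_nonmeasurable => x; rewrite /= in_itv /=.
    (* A supremum is nonnegative once one element is; the pair x1 = x2 = x provides it. *)
    move=> x01; apply: le_ereal_sup_tmp.
    exists (circle_dist (pinched_rotation x (to_circle 0))
                        (pinched_rotation x (to_circle 0)))%:E.
      have bx : ball01 x r x.
        by split; [exact: ballxx | rewrite /= in_itv].
      by exists (to_circle 0), x, x; split.
    by rewrite lee_fin dist_int_ge0.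
  by move=> x01; exact: osc_pinched_rotation.
rewrite integral_indic//=; last exact: measurable_ball.
apply: (@le_trans _ _ (m (ball (2^-1 : R) r))).
  by rewrite le_measure ?inE//; [apply: measurableI => // |];
    exact: measurable_ball.
by rewrite lebesgue_measure_ball; [rewrite invrK -EFinM lee_fin;
  lra | exact: ltW].
Qed.

Lemma pinched_rotation_D2 (theta delta : R) :
  `|theta - p%:~R / k%:~R| + c <= delta ->
  condD2 (rotation_skew theta) pinched_rotation delta.
Proof.
move=> hd x y _; rewrite circle_dist_rotate subrr add0r opprB addrCA addrC.
rewrite -mulrBl; apply: le_trans hd; apply: le_trans (dist_int_norm _) _.
apply: le_trans (ler_normD _ _) _; rewrite !normrM.
apply: lerD.
  by rewrite ler_piMr// indicE; case: (_ \in _); rewrite ?normr1 ?normr0.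
rewrite (ger0_norm c_ge0) ler_piMr// ger0_norm ?dist_int_ge0//.
apply: le_trans (dist_int_le_half _) _; lra.
Qed.

Hypothesis k_gt0 : 0 < k.

(** An exact equality, not just a decrease: the rotation changes k y by an integer, and the pinching
    lowers it by c k ||k y||, which is at most [frac] of k y because c k <= 1 / 2, so no wrap-around
    past 0 occurs. *)
Lemma frac_pinched_rotation x y :
  frac (k%:~R * circle_val (pinched_rotation x y)) +
    c * k%:~R * dist_int (k%:~R * circle_val y) = frac (k%:~R * circle_val y).
Proof.
have k0 : (0 : R) < k%:~R by rewrite ltr0z.
rewrite /= frac_intfrac; set z := k%:~R * circle_val y; set d := dist_int z.
have [n ->] : exists n : int, \1_(`[0, 2^-1] : set R) x = n%:~R :> R.
  by rewrite indicE; case: (_ \in _); [exists 1 | exists 0].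
(* Everything integral is collected on the right: the integer part of k y and the displacement p n
   caused by the rotation. *)
rewrite (_ : k%:~R * _ = (frac z - c * k%:~R * d) + (Num.floor z + p * n)%:~R).
  have /andP[z0 z1] := frac_itv z.
  have d0 : 0 <= d := dist_int_ge0 z.
  have dz : d <= frac z := dist_int_le_frac z.
  have : 0 <= c * k%:~R by rewrite mulr_ge0 // ltW.
  move: ck; rewrite gtr0_norm //; set e := c * _ => e1 e0.
  have : e * d <= d by rewrite ler_piMl //; lra.
  have : 0 <= e * d by rewrite mulr_ge0.
  by move=> *; rewrite fracDz frac_id ?subrK//; lra.
rewrite intrD intrM /frac -/z; have -> : z = k%:~R * circle_val y by [].
by field; rewrite gt_eqF.
Qed.

End fibre_map.

Lemma condD1_refl (R : realType) (T : R -> R) (delta : R) : 0 <= delta ->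
  condD1 T T delta.
Proof.
move=> d0; have id1 x : derive1 (id : R -> R) x = 1 by rewrite derive1_id.
exists id; split => [||x _|x _].
- split => [x||//|x _].
  + exact: derivable_id.
  + by rewrite (_ : derive1 id = fun=> (1 : R));
      [exact: cst_continuous | exact/funext].
  + by split => // x []; exists x.
  + by rewrite id1 oner_neq0.
- by [].
- by rewrite subrr normr0.
- by rewrite id1 invr1 subrr normr0.
Qed.

(** * The doubling map and its transfer operator *)

Section doubling.
Context {R : realType}.

Lemma doubling_itv (x : R) : 0 <= doubling x <= 1.
Proof. by have /andP[-> /ltW ->] := frac_itv (2 * x). Qed.

Lemma doubling_full_branches : full_branches 2^-1 0 (@doubling R).
Proof.
pose b (i : nat) (x : R) := 2 * x - i%:R.
have b1 i (x : R) : is_derive x 1 (b i) 2.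
  by apply: is_derive_eq; rewrite subr0 -[LHS]/(2 * 1) mulr1.
have db i (x : R) : derive1 (b i) x = 2 by rewrite derive1E derive_val.
have dbE i : derive1 (b i) = fun=> 2 by apply/funext.
have ddbE i : derive1 (derive1 (b i)) = fun=> 0.
  by apply/funext => x; rewrite dbE derive1_cst.
exists 2%N, (fun i => i%:R / 2), b; split => [||i _|i i2].
- by rewrite mul0r.
- by rewrite divff.
- by rewrite ltr_pM2r ?invr_gt0// ltr_nat.
have iE : i.+1%:R / 2 = i%:R / 2 + 2^-1 :> R by rewrite -natr1 mulrDl mul1r.
rewrite iE; split => [x xi||||x1 x2 s1 s2 _ _ _ _].
- rewrite /doubling -(@frac_id _ (b i x)); last by rewrite /b; lra.
  by rewrite /b [i%:R]pmulrn -intrN fracDz.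
- split => [x|x|].
  + exact: ex_derive.
  + by rewrite dbE; exact: derivable_cst.
  + by rewrite ddbE; exact: cst_continuous.
- apply/seteqP; split => [_ [x /= + <-]|y /=]; rewrite !in_itv /= /b.
    lra.
  by move=> y01; exists ((y + i%:R) / 2); rewrite /= ?in_itv /=; lra.
- by move=> x _; rewrite db invrK.
- by rewrite !db subrr mul0r.
Qed.

End doubling.

(** * Affine changes of variables for Lebesgue measure *)

Section affine_change_of_variables.
Context {R : realType}.
Local Notation m := (@lebesgue_measure R).
Local Open Scope ereal_scope.

Definition affine (a b x : R) : R := (a * x + b)%R.

Lemma measurable_affine (a b : R) : measurable_fun [set: R] (affine a b).
Proof. by apply: measurable_funD => //; exact: measurable_funM. Qed.

Variables (a b : R).
Hypothesis a_gt0 : (0 < a)%R.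

Lemma lebesgue_measure_affine (E : set R) : measurable E ->
  m (affine a b @^-1` E) = a^-1%:E * m E.
Proof.
move=> mE; have a0 := ltW a_gt0.
pose f : measurableTypeR R -> measurableTypeR R := affine a b.
have mf : measurable_fun setT f := measurable_affine a b.
(* By uniqueness of Lebesgue measure it is enough to compare a times the image measure with [m] on
   half-open intervals. *)
have -> : m E = mscale (NngNum a0) (pushforward m f) E.
  move=> mf'; apply: lebesgue_measure_unique => // _ [[x y]] _ <-.
  transitivity (a%:E * m (f @^-1` `]x, y]%classic)); last by [].
  have -> : f @^-1` `]x, y]%classic = `](x - b) / a, (y - b) / a]%classic%R.
    apply/seteqP; split => z; rewrite /= /f /affine !in_itv /=;
    by rewrite ltr_pdivrMr// ler_pdivlMr// ltrBlDr lerBrDr mulrC.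
  rewrite !lebesgue_measure_itv /= !lte_fin ltr_pM2r ?invr_gt0// ltrD2r.
  case: ifPn => _; last by rewrite mule0.
  by rewrite -!EFinB -EFinM; congr EFin; field; rewrite gt_eqF.
transitivity (a^-1%:E * (a%:E * m (affine a b @^-1` E))); last by [].
by rewrite muleA -EFinM mulVf ?gt_eqF// mul1e.
Qed.

Lemma ge0_integral_affine (D : set R) (g : R -> \bar R) : measurable D ->
  measurable_fun D g -> (forall x, D x -> 0 <= g x) ->
  \int[m]_(x in affine a b @^-1` D) g (affine a b x) =
  a^-1%:E * \int[m]_(x in D) g x.
Proof.
move=> mD mg g0; have a0 : (0 <= a^-1)%R by rewrite invr_ge0 ltW.
rewrite -(ge0_integral_mscale m mD (NngNum a0))//.
pose f : measurableTypeR R -> measurableTypeR R := affine a b.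
have mf : measurable_fun setT f := measurable_affine a b.
transitivity (\int[pushforward m f]_(y in D) g y); last first.
  apply: (eq_measure_integral (mscale (NngNum a0) m)) => //.
  by move=> E mE _; exact: lebesgue_measure_affine.
rewrite (ge0_integral_pushforward mf)// => x; rewrite inE; exact: g0.
Qed.

Lemma integral_affine (D : set R) (g : R -> \bar R) : measurable D ->
  m.-integrable D g ->
  \int[m]_(x in affine a b @^-1` D) g (affine a b x) =
  a^-1%:E * \int[m]_(x in D) g x.
Proof.
move=> mD ig; have mg := measurable_int _ ig.
rewrite integralE [in RHS]integralE.
transitivity (\int[m]_(x in affine a b @^-1` D) g^\+ (affine a b x) -
  \int[m]_(x in affine a b @^-1` D) g^\- (affine a b x)).
  by congr (_ - _); apply: eq_integral => x _; rewrite ?funeposE ?funenegE.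
rewrite !ge0_integral_affine //.
- have mD' : measurable (D : set (measurableTypeR R)) := mD.
  rewrite -muleBr// fin_num_adde_defl// fin_numN.
  exact: (integrable_neg_fin_num mD' ig).
- exact: measurable_funeneg.
- exact: measurable_funepos.
Qed.

Lemma integrable_affine (D : set R) (g : R -> \bar R) : measurable D ->
  m.-integrable D g -> m.-integrable (affine a b @^-1` D) (g \o affine a b).
Proof.
move=> mD ig; have mg := measurable_int _ ig; apply/integrableP; split.
  apply: measurable_comp mg _ => //; first by move=> _ [x + <-].
  exact: measurable_funTS (@measurable_affine _ _).
rewrite (@ge0_integral_affine D (abse \o g))//; last 2 first.
  exact: measurableT_comp.
  by move=> x _; exact: abse_ge0.
move/integrableP : ig => [_ goo].
by rewrite lte_mul_pinfty ?lee_fin ?invr_ge0 ?ltW.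
Qed.

End affine_change_of_variables.

Section transfer_doubling.
Context {R : realType}.
Local Notation m := (@lebesgue_measure R).
Local Notation s0 := (affine (2^-1 : R) 0).
Local Notation s1 := (affine (2^-1 : R) 2^-1).
Implicit Types (phi psi : R -> R) (A : set R).
Local Open Scope ereal_scope.

(** [D0 A] and [D1 A] are the images of A under the inverse branches [s0] and [s1]. The intervals
    are half-open because [doubling] sends 1 to 0, so that the end point 1 would spoil
    [preimage_s1]. *)
Let D0 A : set R := `[0%R, 2^-1%R[ `&` @doubling R @^-1` A.
Let D1 A : set R := `[2^-1%R, 1%R[ `&` @doubling R @^-1` A.

Let preimage_s0 A : s0 @^-1` D0 A = `[0%R, 1%R[ `&` A.
Proof.
apply/seteqP; split => x;
  rewrite /D0 /= !in_itv /= /doubling /affine addr0 => -[].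
  move=> h; have x01 : (0 <= x < 1)%R by lra.
  by rewrite mulVKf// frac_id.
by move=> x01 Ax; rewrite mulVKf// frac_id//; split => //; lra.
Qed.

Let preimage_s1 A : s1 @^-1` D1 A = `[0%R, 1%R[ `&` A.
Proof.
have sE (x : R) : (2 * (2^-1 * x + 2^-1) = x + 1%:~R)%R by field.
apply/seteqP; split => x; rewrite /D1 /= !in_itv /= /doubling /affine => -[].
  move=> h; have x01 : (0 <= x < 1)%R by lra.
  by rewrite sE fracDz frac_id.
by move=> x01 Ax; rewrite sE fracDz frac_id//; split => //; lra.
Qed.

Let measurable_preimage A : measurable A -> measurable (@doubling R @^-1` A).
Proof. by move=> mA; rewrite -[_ @^-1` _]setTI; exact: measurable_doubling. Qed.

Let mD0 A : measurable A -> measurable (D0 A).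
Proof. by move=> mA; apply: measurableI => //; exact: measurable_preimage. Qed.

Let mD1 A : measurable A -> measurable (D1 A).
Proof. by move=> mA; apply: measurableI => //; exact: measurable_preimage. Qed.

Let D01 A : D0 A `|` D1 A = `[0%R, 1%R[ `&` @doubling R @^-1` A.
Proof.
rewrite /D0 /D1 -setIUl; congr (_ `&` _).
apply/seteqP; split => x /=; rewrite !in_itv /=; first by case; lra.
by move=> x01; have [h|h] := ltP x (2^-1)%R; [left|right]; lra.
Qed.

Let D01_disj A : [disjoint D0 A & D1 A].
Proof.
apply/disj_setPS => x [[+ _] [+ _]]; rewrite /= !in_itv /=; lra.
Qed.

Let measurable_comp_s0 A (g : R -> \bar R) : measurable A ->
  measurable_fun (`[0%R, 1%R[ : set R) g ->
  measurable_fun (D0 A) g /\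
  measurable_fun (`[0%R, 1%R[ `&` A : set R) (g \o s0).
Proof.
move=> mA mg; have mgD : measurable_fun (D0 A) g.
  apply: measurable_funS mg => //; rewrite /D0 => x [/= + _].
  by rewrite !in_itv /= => ?; lra.
split => //; rewrite -preimage_s0; apply: measurable_comp mgD _ => //.
- exact: mD0.
- by move=> _ [x + <-].
- exact: measurable_funTS (@measurable_affine R _ _).
Qed.

Let measurable_comp_s1 A (g : R -> \bar R) : measurable A ->
  measurable_fun (`[0%R, 1%R[ : set R) g ->
  measurable_fun (D1 A) g /\
  measurable_fun (`[0%R, 1%R[ `&` A : set R) (g \o s1).
Proof.
move=> mA mg; have mgD : measurable_fun (D1 A) g.
  apply: measurable_funS mg => //; rewrite /D1 => x [/= + _].
  by rewrite !in_itv /= => ?; lra.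
split => //; rewrite -preimage_s1; apply: measurable_comp mgD _ => //.
- exact: mD1.
- by move=> _ [x + <-].
- exact: measurable_funTS (@measurable_affine R _ _).
Qed.

Let half2 (x y : \bar R) : 0 <= x -> 0 <= y ->
  2^-1%:E * (2^-1^-1%:E * x + 2^-1^-1%:E * y) = x + y.
Proof.
move=> x0 y0; rewrite -ge0_muleDr// muleA -EFinM mulfV ?mul1e//.
Qed.

(** Each inverse branch contracts by 1 / 2, so the change of variables produces a factor 2 that
    cancels the weight 1 / 2, and the two images tile the preimage of A. This version serves for L1
    norms and oscillations, the integrable one below for identifying the transfer operator. *)
Lemma ge0_integral_doubling_branches (g : R -> \bar R) A : measurable A ->
  measurable_fun (`[0%R, 1%R[ : set R) g ->
  (forall x, (0 <= x < 1)%R -> 0 <= g x) ->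
  \int[m]_(x in `[0%R, 1%R[ `&` A) (2^-1%:E * (g (s0 x) + g (s1 x))) =
  \int[m]_(x in `[0%R, 1%R[ `&` @doubling R @^-1` A) g x.
Proof.
move=> mA mg g0.
have [m0 m0'] := measurable_comp_s0 mA mg.
have [m1 m1'] := measurable_comp_s1 mA mg.
have g00 x : D0 A x -> 0 <= g x.
  by case=> + _; rewrite /= in_itv /= => ?; apply: g0; lra.
have g01 x : D1 A x -> 0 <= g x.
  by case=> + _; rewrite /= in_itv /= => ?; apply: g0; lra.
have gs0 x : (`[0%R, 1%R[ `&` A) x ->
  0 <= g (s0 x) by rewrite -preimage_s0 => /g00.
have gs1 x : (`[0%R, 1%R[ `&` A) x ->
  0 <= g (s1 x) by rewrite -preimage_s1 => /g01.
have mIA : measurable (`[0%R, 1%R[ `&` A : set (measurableTypeR R)).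
  exact: measurableI.
rewrite ge0_integralZl_EFin//; last 2 first.
  by move=> x Dx; rewrite adde_ge0 ?gs0 ?gs1.
  exact: emeasurable_funD.
rewrite ge0_integralD//.
rewrite -[in X in X + _]preimage_s0 -[in X in _ + X]preimage_s1.
rewrite !ge0_integral_affine//; [|exact: mD1|exact: mD0].
rewrite half2; [|exact: integral_ge0|exact: integral_ge0].
rewrite -ge0_integral_setU ?D01//.
- exact: mD0.
- exact: mD1.
- apply: measurable_funS mg => //; exact: subIsetl.
- by move=> x [+ _]; rewrite /= in_itv /=; exact: g0.
Qed.

Lemma integral_doubling_branches (g : R -> \bar R) A : measurable A ->
  m.-integrable (`[0%R, 1%R[ : set R) g ->
  \int[m]_(x in `[0%R, 1%R[ `&` A) (2^-1%:E * (g (s0 x) + g (s1 x))) =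
  \int[m]_(x in `[0%R, 1%R[ `&` @doubling R @^-1` A) g x.
Proof.
move=> mA ig.
have i0 : m.-integrable (D0 A) g.
  apply: (integrableS _ _ _ ig) => //; first exact: mD0.
  by rewrite /D0 => x [/= + _]; rewrite !in_itv /= => ?; lra.
have i1 : m.-integrable (D1 A) g.
  apply: (integrableS _ _ _ ig) => //; first exact: mD1.
  by rewrite /D1 => x [/= + _]; rewrite !in_itv /= => ?; lra.
have mIA : measurable (`[0%R, 1%R[ `&` A : set (measurableTypeR R)).
  exact: measurableI.
have i0' : m.-integrable (`[0%R, 1%R[ `&` A : set R) (g \o s0).
  by rewrite -preimage_s0; apply: integrable_affine => //; exact: mD0.
have i1' : m.-integrable (`[0%R, 1%R[ `&` A : set R) (g \o s1).
  by rewrite -preimage_s1; apply: integrable_affine => //; exact: mD1.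
rewrite integralZl//; last exact: integrableD.
rewrite integralD//.
rewrite -[in X in X + _]preimage_s0 -[in X in _ + X]preimage_s1.
rewrite !integral_affine//; [|exact: mD1|exact: mD0].
have f0 : \int[m]_(x in D0 A) g x \is a fin_num.
  by apply: integrable_fin_num i0; exact: mD0.
have f1 : \int[m]_(x in D1 A) g x \is a fin_num.
  by apply: integrable_fin_num i1; exact: mD1.
rewrite -muleDr//; last by rewrite fin_num_adde_defl.
rewrite muleA -EFinM mulfV// mul1e.
rewrite -integral_setU ?D01//.
- exact: mD0.
- exact: mD1.
- by apply: measurable_funS (measurable_int _ ig) => //; exact: subIsetl.
Qed.

End transfer_doubling.

Section transfer_operator.
Context {R : realType}.
Local Notation m := (@lebesgue_measure R).
Local Notation s0 := (affine (2^-1 : R) 0).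
Local Notation s1 := (affine (2^-1 : R) 2^-1).
Implicit Types (phi psi : R -> R) (A : set R).
Local Open Scope ereal_scope.

Definition doubling_transfer phi (x : R) : R :=
  (2^-1 * (phi (s0 x) + phi (s1 x)))%R.

Lemma integral_itvco (f : R -> \bar R) A : measurable A ->
  measurable_fun (`[0%R, 1%R] : set R) f ->
  \int[m]_(x in `[0%R, 1%R] `&` A) f x = \int[m]_(x in `[0%R, 1%R[ `&` A) f x.
Proof.
move=> mA mf; rewrite !integral_mkcondr integral_itv_bndo_bndc//.
apply/measurable_restrict => //.
apply: measurable_funS mf => //.
by move=> x [/= + _]; rewrite !in_itv /= => /andP[-> /ltW ->].
Qed.

Lemma integral_itvcoT (f : R -> \bar R) :
  measurable_fun (`[0%R, 1%R] : set R) f ->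
  \int[m]_(x in `[0%R, 1%R]) f x = \int[m]_(x in `[0%R, 1%R[) f x.
Proof.
by move=> mf; rewrite -[X in integral _ X]setIT integral_itvco// setIT.
Qed.

Let itv_co_cc : (`[0%R, 1%R[ : set R) `<=` `[0%R, 1%R].
Proof. by move=> x /=; rewrite !in_itv /= => /andP[-> /ltW ->]. Qed.

Lemma integrable_doubling_transfer phi :
  m.-integrable (`[0%R, 1%R] : set R) (EFin \o phi) ->
  m.-integrable (`[0%R, 1%R] : set R) (EFin \o doubling_transfer phi).
Proof.
move=> iphi; have h0 : (0 < 2^-1 :> R)%R by rewrite invr_gt0.
have -> : EFin \o doubling_transfer phi =
    fun x => 2^-1%:E * (((EFin \o phi) \o s0) \+ ((EFin \o phi) \o s1)) x.
  by apply/funext.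
apply: integrableZl => //; apply: integrableD => //.
  rewrite (_ : `[0%R, 1%R]%classic = s0 @^-1` `[0%R, 2^-1%R]); last first.
    by apply/seteqP; split => x; rewrite /= !in_itv /= /affine; lra.
  apply: integrable_affine => //; apply: integrableS iphi => //.
  by move=> x /=; rewrite !in_itv /=; lra.
rewrite (_ : `[0%R, 1%R]%classic = s1 @^-1` `[2^-1%R, 1%R]); last first.
  by apply/seteqP; split => x; rewrite /= !in_itv /= /affine; lra.
apply: integrable_affine => //; apply: integrableS iphi => //.
by move=> x /=; rewrite !in_itv /=; lra.
Qed.

Lemma is_transfer_doubling phi :
  m.-integrable (`[0%R, 1%R] : set R) (EFin \o phi) ->
  is_transfer (@doubling R) phi (doubling_transfer phi).
Proof.
move=> iphi; have ipsi := integrable_doubling_transfer iphi.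
split => // A mA.
rewrite integral_itvco//; last exact: measurable_int ipsi.
rewrite integral_itvco; last 2 first.
  by rewrite -[_ @^-1` _]setTI; exact: measurable_doubling.
  exact: measurable_int iphi.
rewrite -(@integral_doubling_branches _ (EFin \o phi))//.
exact: integrableS iphi.
Qed.

(** [transfer] is an arbitrary choice of density. The explicit operator shows that a density exists,
    and two densities with the same integrals over all measurable sets agree almost everywhere. *)
Lemma transfer_doublingP phi :
  m.-integrable (`[0%R, 1%R] : set R) (EFin \o phi) ->
  m.-integrable (`[0%R, 1%R] : set R) (EFin \o transfer (@doubling R) phi) /\
  {ae m, forall x : measurableTypeR R, (0 <= (x : R) <= 1)%R ->
    transfer (@doubling R) phi x = doubling_transfer phi x}.
Proof.
move=> iphi; have tphi := is_transfer_doubling iphi.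
have [ipsi psiE] : is_transfer (@doubling R) phi (transfer (@doubling R) phi).
  by apply: (@getPex _ (is_transfer (@doubling R) phi));
    exists (doubling_transfer phi).
split => //.
have : ae_eq m (`[0%R, 1%R] : set R)
    (EFin \o transfer (@doubling R) phi) (EFin \o doubling_transfer phi).
  apply: integral_ae_eq => //; first exact: measurable_int tphi.1.
  move=> E E01 mE; have := psiE _ mE; rewrite -tphi.2//.
  by rewrite (setIidr E01).
by apply: filterS => x /= h x01; have := h; rewrite in_itv /= => /(_ x01) [].
Qed.

Lemma L1_norm_transfer phi :
  m.-integrable (`[0%R, 1%R] : set R) (EFin \o phi) ->
  L1_norm (transfer (@doubling R) phi) <= L1_norm phi.
Proof.
move=> iphi; have [ipsi psiE] := transfer_doublingP iphi.
have mphi : measurable_fun (`[0%R, 1%R] : set R) phi.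
  by apply/measurable_EFinP; exact: measurable_int iphi.
have mabs (f : R -> R) : m.-integrable (`[0%R, 1%R] : set R) (EFin \o f) ->
    measurable_fun (`[0%R, 1%R] : set R) (fun x => `|f x|%:E).
  move=> /measurable_int mf; apply/measurable_EFinP;
    apply: measurableT_comp => //.
  exact/measurable_EFinP.
rewrite /L1_norm.
have -> : \int[m]_(x in `[0%R, 1%R]) `|transfer (@doubling R) phi x|%:E =
    \int[m]_(x in `[0%R, 1%R]) `|doubling_transfer phi x|%:E.
  apply: ae_eq_integral => //; first exact: mabs.
    by apply: mabs; exact: integrable_doubling_transfer.
  by move: psiE; apply: filterS => x /= h; rewrite in_itv /= => /h ->.
rewrite integral_itvcoT; last by apply: mabs;
  exact: integrable_doubling_transfer.
rewrite integral_itvcoT; last exact: mabs.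
have := @ge0_integral_doubling_branches R (fun x =>
  `|phi x|%:E) setT measurableT.
rewrite preimage_setT !setIT => <- //;
  last exact: measurable_funS (mabs _ iphi).
apply: ge0_le_integral_nonmeasurable => x _ //=.
by rewrite lee_fin /doubling_transfer normrM gtr0_norm// ler_wpM2l// ler_normD.
Qed.

End transfer_operator.

(** * Essential oscillation of the image under the transfer operator *)

Section oscillation.
Context {R : realType}.
Local Notation RT := (measurableTypeR R).
Local Notation m := (@lebesgue_measure R).
Local Notation s0 := (affine (2^-1 : R) 0).
Local Notation s1 := (affine (2^-1 : R) 2^-1).
Implicit Types (phi psi : R -> R).
Local Open Scope ereal_scope.

(** [ess_osc] is an essential supremum over pairs, so statements about almost every point have to be
    carried to each coordinate of almost every pair. *)
Lemma ae_fst (P : RT -> Prop) :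
  {ae m, forall x, P x} -> {ae m \x m, forall p, P p.1}.
Proof.
move=> [N [mN N0 PN]]; exists (N `*` setT); split.
- exact: measurableX.
- by rewrite [LHS]product_measure1E// [X in X * _]N0 mul0e.
- by move=> p /= /PN.
Qed.

Lemma ae_snd (P : RT -> Prop) :
  {ae m, forall x, P x} -> {ae m \x m, forall p, P p.2}.
Proof.
move=> [N [mN N0 PN]]; exists (setT `*` N); split.
- exact: measurableX.
- by rewrite [LHS]product_measure1E// [X in _ * X]N0 mule0.
- by move=> p /= /PN.
Qed.

(** The preimage of a null set under an affine map acting on both coordinates is null: the map
    scales the measure of each section by 1 / a, and the outer integral by 1 / a again. *)
Lemma ae_affine (a b : R) (P : RT * RT -> Prop) : (0 < a)%R ->
  {ae m \x m, forall p, P p} ->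
  {ae m \x m, forall p, P (affine a b p.1, affine a b p.2)}.
Proof.
move=> a0 [N [mN N0 PN]].
pose S (p : RT * RT) : RT * RT := (affine a b p.1, affine a b p.2).
have mS : measurable_fun setT S.
  apply/measurable_fun_pairP; split.
    exact: (measurableT_comp (@measurable_affine R a b)).
  exact: (measurableT_comp (@measurable_affine R a b)).
have mSN : measurable (S @^-1` N) by rewrite -[_ @^-1` _]setTI; exact: mS.
exists (S @^-1` N); split => //; last by move=> p /= /PN.
pose g (u : R) := m (xsection N u).
have mg : measurable_fun [set: R] g := measurable_fun_xsection m mN.
have g0 : \int[m]_u g u = 0 by exact: N0.
transitivity (\int[m]_u (a^-1%:E * g (affine a b u))).
  apply: eq_integral => u _; rewrite -(lebesgue_measure_affine b a0);
    last first.
    exact: measurable_xsection.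
  by congr (m _); apply/seteqP; split => v; rewrite /xsection /= !inE.
rewrite ge0_integralZl_EFin ?invr_ge0 ?ltW//;
  last exact: (measurableT_comp mg (@measurable_affine R a b)).
have := @ge0_integral_affine R a b a0 setT g measurableT mg (fun _ _ =>
  measure_ge0 _ _).
by rewrite preimage_setT => ->; rewrite g0 !mule0.
Qed.

Lemma ess_osc_ge0 phi x r : 0 <= ess_osc phi x r.
Proof.
apply: ess_sup_gee.
  (* For the zero measure an essential supremum would be -oo, hence the check that the total mass is
     positive. *)
  have m0 : 0 < m [set: RT].
    rewrite (_ : [set: RT] = `]-oo, +oo[%classic); last by rewrite set_itvNyy.
    by rewrite lebesgue_measure_itv /= addye// ltry.
  apply: (@lt_le_trans _ _ (m setT * m setT)); first by rewrite mule_gt0.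
  by rewrite -product_measure1E// setXTT.
by apply: nearW => p; rewrite patchE; case: ifP.
Qed.

(** Each inverse branch halves distances and thus maps the ball of radius r around x into the ball
    of radius r / 2 around the image of x. The change of scale is the source of the contraction in
    the Lasota-Yorke inequality. *)
Lemma ess_osc_transfer phi psi x r : (0 < r)%R -> (0 <= x <= 1)%R ->
  {ae m, forall u : RT, (0 <= (u : R) <= 1)%R ->
    psi u = doubling_transfer phi u} ->
  ess_osc psi x r <=
    2^-1%:E * (ess_osc phi (s0 x) (r / 2) + ess_osc phi (s1 x) (r / 2)).
Proof.
move=> r0 x01 psiE; apply/ess_supP.
have h2 : (0 < 2^-1 :> R)%R by rewrite invr_gt0.
pose F y := (fun p : RT * RT => `|phi p.1 - phi p.2|%:E) \_
   (ball01 (y : R) (r / 2) `*` ball01 (y : R) (r / 2)).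
have e0 := ae_affine 0%R h2 (ess_sup_ge (m \x m) (F (s0 x))).
have e1 := ae_affine 2^-1%R h2 (ess_sup_ge (m \x m) (F (s1 x))).
have e2 := ae_fst psiE.
have e3 := ae_snd psiE.
have FF : Filter (nbhs (almost_everywhere (m \x m))).
  exact: ae_filter_ringOfSetsType.
have e01 := @filterI _ _ FF _ _ e0 e1.
have e23 := @filterI _ _ FF _ _ e2 e3.
apply: (@filterS2 _ _ FF _ _ _ _ e01 e23) => p /= [f0 f1] [f2 f3].
have b0 u : ball01 x r u -> ball01 (s0 x) (r / 2) (s0 u).
  rewrite /ball01 /ball /= !in_itv /= /affine => -[];
    rewrite !addr0 -mulrBr normrM gtr0_norm// => h u01; split;
      first by rewrite mulrC ltr_pM2r.
  lra.
have b1 u : ball01 x r u -> ball01 (s1 x) (r / 2) (s1 u).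
  rewrite /ball01 /ball /= !in_itv /= /affine => -[];
    rewrite opprD addrACA subrr addr0 -mulrBr normrM gtr0_norm// => h u01;
      split; first by rewrite mulrC ltr_pM2r.
  lra.
rewrite patchE; case: ifPn => [|_]; last first.
  by rewrite mule_ge0 ?adde_ge0 ?ess_osc_ge0 ?lee_fin ?ltW.
rewrite inE => -[p1 p2].
have h0 : `|phi (s0 p.1) - phi (s0 p.2)|%:E <= ess_osc phi (s0 x) (r / 2).
  by move: f0; rewrite /F patchE ifT// inE; split; exact: b0.
have h1 : `|phi (s1 p.1) - phi (s1 p.2)|%:E <= ess_osc phi (s1 x) (r / 2).
  by move: f1; rewrite /F patchE ifT// inE; split; exact: b1.
have -> : psi p.1 = doubling_transfer phi p.1.
  have p101 : (0 <= (p.1 : R) <= 1)%R by case: p1 => _; rewrite /= in_itv.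
  exact: f2.
have -> : psi p.2 = doubling_transfer phi p.2.
  have p201 : (0 <= (p.2 : R) <= 1)%R by case: p2 => _; rewrite /= in_itv.
  exact: f3.
apply: le_trans (lee_wpmul2l _ (leeD h0 h1)); last by rewrite lee_fin ltW.
rewrite -EFinD -EFinM lee_fin /doubling_transfer -mulrBr normrM gtr0_norm//.
rewrite ler_wpM2l ?(ltW h2)//; apply: le_trans (ler_normD _ _).
by rewrite opprD addrACA.
Qed.

End oscillation.

Section lasota_yorke.
Context {R : realType}.
Local Notation RT := (measurableTypeR R).
Local Notation m := (@lebesgue_measure R).
Local Notation s0 := (affine (2^-1 : R) 0).
Local Notation s1 := (affine (2^-1 : R) 2^-1).
Implicit Types (phi psi : R -> R).
Local Open Scope ereal_scope.

(** The change of variables in [var_transfer] integrates this function of x. It exceeds a exactly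
    when the pairs with oscillation above a have nonzero measure, and that measure depends
    measurably on x by Tonelli's theorem. *)
Lemma measurable_ess_osc phi r : measurable_fun (`[0%R, 1%R] : set R) phi ->
  measurable_fun [set: RT] (fun x => ess_osc phi x r).
Proof.
move=> mphi.
(* [phi] is only assumed measurable on [0, 1]; extending it by 0 changes nothing on [W], whose pairs
   lie in [0, 1]. *)
pose phi' : RT -> R := phi \_ (`[0%R, 1%R] : set R).
have m01 : measurable (`[0%R, 1%R] : set RT) by exact: measurable_itv.
have mphi' : measurable_fun [set: RT] phi' :=
  (measurable_restrictT (phi : RT -> R) m01).1 mphi.
pose W : set (RT * RT * RT) :=
  [set q | ball01 (q.1.1 : R) r q.1.2 /\ ball01 (q.1.1 : R) r q.2].
pose G := (fun q : RT * RT * RT => `|phi' q.1.2 - phi' q.2|%:E) \_ W.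
have mB (f g : RT * RT * RT -> R) : measurable_fun setT f ->
  measurable_fun setT g ->
    measurable [set q | ball01 (f q) r (g q)].
  move=> mf mg.
  rewrite (_ : [set _ | _] = (setT `&` (fun q =>
    `|f q - g q|%R) @^-1` `]-oo, r[) `&`
      (setT `&` g @^-1` `[0%R, 1%R])); last first.
    by rewrite !setTI; apply/seteqP; split => q;
      rewrite /ball01 /ball /= !in_itv.
  apply: measurableI; last exact: mg.
  have : measurable_fun setT (fun q => `|f q - g q|%R).
    by apply: measurableT_comp => //; exact: measurable_funB.
  by apply.
have m11 : measurable_fun setT (fun q : RT * RT * RT => q.1.1).
  exact: (measurableT_comp measurable_fst measurable_fst).
have m12 : measurable_fun setT (fun q : RT * RT * RT => q.1.2).
  exact: (measurableT_comp measurable_snd measurable_fst).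
have m2 : measurable_fun setT (fun q : RT * RT * RT => q.2) := measurable_snd.
have mW : measurable W by apply: measurableI; exact: mB.
have mG : measurable_fun setT G.
  have mn : measurable_fun setT (fun q : RT * RT * RT =>
    `|phi' q.1.2 - phi' q.2|%R).
    apply: measurableT_comp => //.
    apply: measurable_funB.
      exact: (measurableT_comp mphi' m12).
    exact: (measurableT_comp mphi' m2).
  have mn' : measurable_fun setT (fun q : RT * RT * RT =>
    `|phi' q.1.2 - phi' q.2|%:E).
    exact/measurable_EFinP.
  by apply/(measurable_restrictT _ mW); exact: measurable_funTS.
pose F (x : RT) (p : RT * RT) := G (x, p.1, p.2).
have mF x : measurable_fun setT (F x).
  apply: (measurableT_comp mG); apply/measurable_fun_pairP; split.
    by apply/measurable_fun_pairP; split;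
      [exact: measurable_cst | exact: measurable_fst].
  exact: measurable_snd.
have oscE x : ess_osc phi x r = ess_sup (m \x m) (F x).
  congr (ess_sup _ _); apply/funext => p; rewrite /F /G !patchE.
  have -> : (p \in ball01 x r `*` ball01 x r) = ((x, p.1, p.2) \in W).
    by apply/idP/idP; rewrite !inE.
  case: ifPn => // /set_mem [[_ p1] [_ p2]].
  by rewrite /phi' !patchE !ifT ?inE.
apply: (measurability _ (ErealGenOInfty.measurableE R)) => // _ [_ [a ->] <-];
  rewrite setTI.
pose S := G @^-1` `]a%:E, +oo[.
have mS : measurable S.
  by rewrite -[S]setTI; apply: mG => //; exact: emeasurable_itv.
pose h := fun q : RT * RT => m (xsection S q).
have mh : measurable_fun setT h := measurable_fun_xsection m mS.
pose H (x : RT) := \int[m]_u h (x, u).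
have mH : measurable_fun setT H.
  by apply: (measurable_fun_fubini_tonelli_F (m2 := m)) => // q;
    exact: measure_ge0.
rewrite (_ : _ @^-1` _ = setT `&` H @^-1` (~` [set 0])); last first.
  rewrite setTI; apply/seteqP.
  have HE x : H x = (m \x m) (F x @^-1` `]a%:E, +oo[).
    by apply: eq_integral => u _; rewrite /h; congr (m _).
  split => x /=; rewrite in_itv /= andbT oscE.
    move=> + H0; rewrite ltNge => /negP; apply; apply/ess_supP.
    by apply: (ae_le_measureP _ _ (mF x)).2; rewrite -H0; exact/esym/HE.
  move=> H0; rewrite ltNge; apply/negP => /ess_supP Fa; apply: H0; rewrite HE.
  exact: (ae_le_measureP _ _ (mF x)).1 Fa.
by apply: mH => //; exact: measurableC.
Qed.

Local Notation var A phi := (ereal_sup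
  [set (r : R)^-1%:E * \int[m]_(x in `[0%R, 1%R]) ess_osc phi x r
  | r in `]0%R, A] : set R]).

(** The oscillations at radius r / 2 along both branches integrate to the oscillation of [phi] at
    that radius, and 1 / r is half of 1 / (r / 2). The radius r / 2 still lies in ]0, A], so the
    supremum is halved. *)
Lemma var_transfer phi (A : R) :
  m.-integrable (`[0%R, 1%R] : set R) (EFin \o phi) ->
  var A (transfer (@doubling R) phi) <= 2^-1%:E * var A phi.
Proof.
move=> iphi; have [_ psiE] := transfer_doublingP iphi.
have mphi : measurable_fun (`[0%R, 1%R] : set R) phi.
  by apply/measurable_EFinP; exact: measurable_int iphi.
apply: ge_ereal_sup => _ [r /= + <-]; rewrite in_itv /= => /andP[r0 rA].
have mosc := measurable_ess_osc (r / 2) mphi.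
have osc0 := ess_osc_ge0 phi.
apply: (@le_trans _ _ (r^-1%:E * \int[m]_(x in `[0%R, 1%R])
    (2^-1%:E * (ess_osc phi (s0 x) (r / 2) + ess_osc phi (s1 x) (r / 2))))).
  apply: lee_wpmul2l; first by rewrite lee_fin invr_ge0 ltW.
  apply: ge0_le_integral_nonmeasurable => x; rewrite /= in_itv /= => x01.
    exact: ess_osc_ge0.
  exact: ess_osc_transfer.
rewrite integral_itvcoT; last first.
  apply: measurable_funTS; apply: measurable_funeM; apply: emeasurable_funD.
    exact: (measurableT_comp mosc (measurable_affine _ _)).
  exact: (measurableT_comp mosc (measurable_affine _ _)).
have := @ge0_integral_doubling_branches R (fun x =>
  ess_osc phi x (r / 2)) setT measurableT.
rewrite preimage_setT !setIT => -> //; last exact: measurable_funTS.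
rewrite -integral_itvcoT; last exact: measurable_funTS.
have -> : (r^-1 = 2^-1 * (r / 2)^-1)%R by field; rewrite gt_eqF.
rewrite EFinM -muleA lee_wpmul2l//.
apply: ereal_sup_ubound; exists (r / 2)%R => //.
by rewrite /= in_itv /=; lra.
Qed.

Lemma iter_transfer_doubling phi (A : R) n :
  m.-integrable (`[0%R, 1%R] : set R) (EFin \o phi) ->
  [/\ m.-integrable (`[0%R, 1%R] : set R)
        (EFin \o iter n (transfer (@doubling R)) phi),
      L1_norm (iter n (transfer (@doubling R)) phi) <= L1_norm phi &
      var A (iter n (transfer (@doubling R)) phi) <=
        (2^-1 ^+ n)%:E * var A phi].
Proof.
move=> iphi; elim: n => [|n [IH1 IH2 IH3]]; first by split => //;
  rewrite expr0 mul1e.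
split.
- exact: (transfer_doublingP IH1).1.
- exact: le_trans (L1_norm_transfer IH1) IH2.
- apply: le_trans (var_transfer A IH1) _.
  by rewrite exprS EFinM -muleA lee_wpmul2l.
Qed.

(** The variation shrinks by 2^-n while the L1 norm merely does not increase; the latter therefore
    accounts for the constant B_T = 1. *)
Lemma doubling_lasota_yorke : lasota_yorke 2^-1 1 1 (@doubling R).
Proof.
exists 1%R => phi n iphi _; rewrite mul1r mul1e /BV_norm.
have [_ L1n vn] := iter_transfer_doubling 1 n iphi.
have h0 : (0 <= 2^-1 ^+ n :> R)%R by rewrite exprn_ge0.
have L10 : 0 <= L1_norm phi by apply: integral_ge0 => x _; rewrite lee_fin.
have v0 : 0 <= var 1%R phi.
  apply: (@le_trans _ _ (1^-1%:E * \int[m]_(x in `[0%R, 1%R]) ess_osc phi x 1)).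
    by rewrite mule_ge0 ?lee_fin ?invr_ge0//; apply: integral_ge0 => x _;
      exact: ess_osc_ge0.
  by apply: ereal_sup_ubound; exists 1%R => //; rewrite /= in_itv /= ltr01 lexx.
rewrite addeC leeD//; apply: le_trans vn _.
by rewrite lee_wpmul2l ?lee_fin// leeDr.
Qed.

Lemma doubling_condA1 : condA1 2^-1 0 1 1 (@doubling R).
Proof.
by split; [move=> x _; exact: doubling_itv | exact: doubling_full_branches |
  exact: doubling_lasota_yorke].
Qed.

End lasota_yorke.

(** * Lower bound for the norm *)

Section jordan_parts.
Context {R : realType} d (T : measurableType d).
Implicit Type nu : {charge set T -> \bar R}.
Local Open Scope ereal_scope.

(** For any Hahn decomposition (P, N), the negative part of E is minus the charge of E cut by N,
    hence at most 0 here. This makes the arbitrary choice behind [pos_part] and [neg_part]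
    harmless. *)
Lemma jordan_parts_of_positive nu (E : set T) : measurable E ->
  (forall A, measurable A -> A `<=` E -> 0 <= nu A) ->
  pos_part nu E = nu E /\ neg_part nu E = 0.
Proof.
move=> mE nu0; rewrite /pos_part /neg_part.
case: (cid (Hahn_decomposition nu)) => P /= hP; case: (cid _) => N /= nuPN.
have [_ [mN _] _ _] := nuPN.
have neg0 : jordan_neg nuPN E = 0.
  apply/eqP; rewrite eq_le measure_ge0 andbT.
  rewrite jordan_negE cjordan_negE /crestr0 mem_set// /crestr leeNl oppe0.
  by apply: nu0; [exact: measurableI | exact: subIsetl].
split => //; rewrite (jordan_decomp nuPN mE).
transitivity (jordan_pos nuPN E + (-1)%:E * jordan_neg nuPN E); last by [].
by rewrite neg0 mule0 adde0.
Qed.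

(** Only the set {g > 0} contributes to the integrals, and there the charge coincides with a
    measure, so its Jordan parts are that measure and 0. *)
Lemma charge_integral_eq nu (m : {finite_measure set T -> \bar R}) (g : T ->
  R) :
  measurable_fun setT g -> (forall x, (0 <= g x)%R) ->
  (forall A, measurable A -> (forall x, A x -> (0 < g x)%R) -> nu A = m A) ->
  charge_integral nu g = fine (\int[m]_x (g x)%:E).
Proof.
move=> mg g0 num; pose Z := [set x | (0 < g x)%R].
have mZ : measurable Z.
  rewrite (_ : Z = setT `&` g @^-1` `]0%R, +oo[); last first.
    by rewrite setTI; apply/seteqP; split => x; rewrite /Z /= in_itv /= andbT.
  exact: mg.
have mgE : measurable_fun setT (fun x => (g x)%:E) by exact/measurable_EFinP.
have intZ (mu : {measure set T -> \bar R}) :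
    \int[mu]_x (g x)%:E = \int[mu]_(x in Z) (g x)%:E.
  rewrite [RHS]integral_mkcond; apply: eq_integral => x _; rewrite patchE.
  case: ifPn => // /negP; rewrite inE /Z /= => /negP; rewrite -leNgt => gx.
  by congr EFin; apply/le_anti; rewrite gx g0.
have jp A : measurable A -> A `<=` Z ->
  pos_part nu A = m A /\ neg_part nu A = 0.
  move=> mA AZ; rewrite -(num A mA AZ);
    apply: jordan_parts_of_positive => // B mB BA.
  by rewrite num ?measure_ge0// => x /BA /AZ.
rewrite /charge_integral /Rintegral.
have -> : \int[pos_part nu]_x (g x)%:E = \int[m]_x (g x)%:E.
  by rewrite !intZ; apply: eq_measure_integral => A mA AZ;
    exact: (jp A mA AZ).1.
have -> : \int[neg_part nu]_x (g x)%:E = 0.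
  rewrite intZ -[RHS](@integral_measure_zero _ _ _ Z (fun x => (g x)%:E)).
  by apply: eq_measure_integral => A mA AZ; exact: (jp A mA AZ).2.
by rewrite subr0.
Qed.

End jordan_parts.

Section one_norm_lower_bound.
Context {R : realType}.
Local Notation RT := (measurableTypeR R).
Local Notation XT := (measurableTypeR R * circle R)%type.
Local Notation m := (@lebesgue_measure R).
Local Open Scope ereal_scope.
Import HBNNSimple.

Lemma disintegration_snd (nu : {measure set XT -> \bar R}) phi
    (kappa : R -> probability (circle R) R) (B : set (circle R)) :
  disintegration nu phi kappa -> measurable B ->
  nu (setT `*` B) = \int[m]_(s in `[0%R, 1%R]) (kappa s B * (phi s)%:E).
Proof.
move=> [_ _ _ _ nuE] mB; rewrite nuE; last exact: measurableX.
by apply: eq_integral => s _; rewrite in_xsectionX ?inE.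
Qed.

Variables (lam mu : probability XT R) (g : circle R -> R).
Hypothesis mg : measurable_fun setT g.
Hypothesis g_ge0 : forall y, (0 <= g y)%R.
Hypothesis g_le1 : forall y, (g y <= 1)%R.
Hypothesis g_lip : forall y z, (`|g y - g z| <= circle_dist y z)%R.

Local Notation nu :=
  (csub (charge_of_finite_measure lam) (charge_of_finite_measure mu)).
Let Z := [set y | (0 < g y)%R].

Let mZ : measurable Z.
Proof.
rewrite (_ : Z = setT `&` g @^-1` `]0%R, +oo[); first exact: mg.
by rewrite setTI; apply/seteqP; split => x; rewrite /Z /= in_itv /= andbT.
Qed.

Hypothesis muZ : mu (setT `*` Z) = 0.

Let muZ0 (A : set XT) : measurable A -> A `<=` setT `*` Z -> mu A = 0.
Proof.
move=> mA AZ; apply/eqP; rewrite eq_le measure_ge0 andbT -muZ.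
by rewrite le_measure ?inE//; exact: measurableX.
Qed.

Let parts (B : set (circle R)) : measurable B -> B `<=` Z ->
  pos_part nu (setT `*` B) = lam (setT `*` B) /\ neg_part nu (setT `*` B) = 0.
Proof.
move=> mB BZ; have mTB : measurable ([set: RT] `*` B) by exact: measurableX.
have nuE (A : set XT) : measurable A -> A `<=` setT `*` B -> nu A = lam A.
  move=> mA AB; transitivity (lam A - mu A); first by [].
  by rewrite muZ0 ?sube0// => p /AB [? /BZ].
rewrite -[in X in X /\ _](nuE (setT `*` B))//.
apply: jordan_parts_of_positive => // A mA AB.
by rewrite nuE ?measure_ge0.
Qed.

(** When the negative slice does not charge {g > 0}, the function g is an admissible test that sees
    the positive slice alone. *)
Let W1_slice phip (kp : R -> probability (circle R) R) phin
    (kn : R -> probability (circle R) R) (s : R) :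
  (0 <= phip s)%R -> kn s Z * (phin s)%:E = 0 ->
  (phip s)%:E * \int[kp s]_y (g y)%:E <=
    W1_norm (csub (slice phip kp s) (slice phin kn s)).
Proof.
move=> p0 n0.
set sigma := csub _ _.
have ig : \int[kp s]_y (g y)%:E \is a fin_num.
  rewrite ge0_fin_numE; last by apply: integral_ge0 => y _; rewrite lee_fin.
  apply: (@le_lt_trans _ _ (\int[kp s]_y (cst 1 y))).
    by apply: ge0_le_integral_nonmeasurable => y _; rewrite lee_fin.
  by rewrite integral_cst// mul1e (le_lt_trans (probability_le1 _ _))// ltry.
have chE : charge_integral sigma g = (phip s * fine (\int[kp s]_y (g y)%:E))%R.
  rewrite (charge_integral_eq (m := mscale (NngNum p0) (kp s)))//; last first.
    move=> A mA AZ.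
    transitivity ((phip s)%:E * kp s A - (phin s)%:E * kn s A); first by [].
    transitivity ((phip s)%:E * kp s A); last by [].
    have [-> |f0] := eqVneq (phin s) 0%R; first by rewrite mul0e sube0.
    have knZ : kn s Z = 0.
      by move/eqP : n0; rewrite mule_eq0 eqe (negbTE f0) orbF => /eqP.
    have -> : kn s A = 0.
      by apply/eqP; rewrite eq_le measure_ge0 andbT -knZ le_measure ?inE.
    by rewrite mule0 sube0.
  rewrite ge0_integral_mscale//.
  - by rewrite fineM.
  - exact/measurable_EFinP.
  - by move=> y _; rewrite lee_fin.
apply: ereal_sup_ubound; exists g.
  by split => // y; rewrite ger0_norm.
rewrite chE ger0_norm;
  last by rewrite mulr_ge0// fine_ge0// integral_ge0// => y _; rewrite lee_fin.
by rewrite EFinM fineK.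
Qed.

(** A disintegration computes measures of sets, so g is approximated from below by simple functions
    h, whose nonzero level sets lie in [Z], where the positive part of [nu] is [lam]. Summing over
    levels gives the integral over s of the h-means of the positive slices, which [W1_slice] bounds
    for almost every s. *)
Lemma one_norm_ge : \int[lam]_p (g p.2)%:E <= one_norm nu.
Proof.
apply: le_ereal_inf_tmp => _ [phip [kp [phin [kn [dp dn ->]]]]].
have msnd : measurable_fun setT (snd : XT -> circle R) := measurable_snd.
have -> : \int[lam]_p (g p.2)%:E =
    \int[pushforward lam (snd : XT -> circle R)]_y (g y)%:E.
  rewrite (ge0_integral_pushforward msnd)//; first exact/measurable_EFinP.
  by move=> y _; rewrite lee_fin.
rewrite ge0_integralTE//.
apply: ge_ereal_sup => _ [h /= hg <-].
pose B r := h @^-1` [set r].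
have mB r : measurable (B r) by exact: measurable_sfunP.
have [mphip phip0 _ mkp _] := dp.
have [mphin phin0 _ mkn _] := dn.
have m01 : measurable (`[0%R, 1%R] : set RT) by exact: measurable_itv.
pose f r s := r%:E * (kp s (B r) * (phip s)%:E).
have mf r : measurable_fun [set: RT] (f r).
  apply: measurable_funeM; apply: emeasurable_funM; first exact: mkp.
  exact/measurable_EFinP.
have f0 r s : 0 <= f r s.
  have [r0|r0] := leP 0%R r.
    by rewrite !mule_ge0 ?lee_fin.
  by rewrite /f /B preimage_nnfun0// measure0 mul0e mule0.
pose a s := \sum_(r \in range h) f r s.
have ma : measurable_fun [set: RT] a.
  by apply: emeasurable_fsum => //; exact: fimfunP.
have a0 s : 0 <= a s by apply: fsume_ge0 => r _.
have aE s : a s = (phip s)%:E * \int[kp s]_y (h y)%:E.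
  rewrite integralT_nnsfun sintegralE muleC ge0_mule_fsuml; last first.
    by move=> r; exact: nnsfun_mulemu_ge0.
  by apply: eq_fsbigr => r _; rewrite /f muleA.
have a_le s : a s <= (phip s)%:E * \int[kp s]_y (g y)%:E.
  rewrite aE lee_wpmul2l ?lee_fin//;
    apply: ge0_le_integral_nonmeasurable => y _.
    by rewrite lee_fin.
  exact: hg.
have mknZ : measurable_fun [set: RT] (fun s => kn s Z * (phin s)%:E).
  by apply: emeasurable_funM; [exact: mkn | exact/measurable_EFinP].
(* The negative part of [nu] gives no mass to the points above [Z], so almost every negative slice
   gives no mass to [Z]. *)
have [N [mN N0 hN]] : ae_eq m (`[0%R, 1%R] : set RT) (fun s =>
  kn s Z * (phin s)%:E) (cst 0).
  apply/ae_eq_integral_abs => //; first exact: measurable_funTS.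
  rewrite -[RHS](parts mZ (@subset_refl _ Z)).2 (disintegration_snd dn mZ).
  by apply: eq_integral => s _; rewrite gee0_abs// mule_ge0 ?lee_fin.
apply: (@le_trans _ _ (\int[m]_(s in `[0%R, 1%R]) a s)).
  rewrite sintegralE ge0_integral_fsum//; last by move=> r;
    exact: measurable_funTS.
  rewrite le_eqVlt; apply/orP; left; apply/eqP/eq_fsbigr => r;
    rewrite inE => -[y _ hy].
  have r0 : (0 <= r)%R by rewrite -hy.
  rewrite ge0_integralZl_EFin//; last 2 first.
  - by move=> s _; rewrite mule_ge0 ?lee_fin.
  - apply: measurable_funTS; apply: emeasurable_funM; first exact: mkp.
    exact/measurable_EFinP.
  (* The level r = 0 is set apart, since its level set need not lie in [Z]. *)
  have [->|rN0] := eqVneq r 0%R; first by rewrite !mul0e.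
  congr (_ * _); rewrite -(disintegration_snd dp (mB r)).
  have BZ : B r `<=` Z.
    move=> z hz; rewrite /Z /=; have := hg z; rewrite lee_fin hz;
      apply: lt_le_trans.
    by rewrite lt_neqAle eq_sym rN0.
  transitivity (lam (setT `*` B r)); last exact/esym/((parts (mB r) BZ).1).
  congr (lam _).
  by apply/seteqP; split => -[p q] /=; [move=> ?; split | case].
rewrite (ge0_negligible_integral mN m01 _ _ N0)//; last exact: measurable_funTS.
(* The null set [N] is removed on the left only, because the norm of the slices is not known to be
   measurable in s. On [N] the left integrand becomes 0 and the right one is nonnegative. *)
rewrite setDE integral_mkcondr; apply: ge0_le_integral_nonmeasurable => s s01.
  by rewrite patchE; case: ifP.
rewrite patchE; case: ifPn => [|_].
  rewrite inE => sN; apply: le_trans (a_le s) _; apply: W1_slice => //.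
  by apply: contrapT => ks; apply: sN; apply: hN => /(_ s01).
set sigma := csub _ _.
apply: (@le_trans _ _ `|charge_integral sigma g|%:E); first by rewrite lee_fin.
by apply: ereal_sup_ubound; exists g => //; split => // y; rewrite ger0_norm.
Qed.

End one_norm_lower_bound.

(** * The mean of ||k y|| under invariant measures and under Lebesgue measure *)

Section invariant_measures.
Context {R : realType}.
Local Notation XT := (measurableTypeR R * circle R)%type.
Local Notation m := (@lebesgue_measure R).
Local Open Scope ereal_scope.

Variables (k p : int) (c : R).
Hypothesis c_gt0 : (0 < c)%R.
Hypothesis ck : (c * `|k%:~R| <= 2^-1)%R.
Hypothesis k_gt0 : (0 < k)%R.

(** Integrating V = V o F + c k D and using invariance gives the same integral of V on both sides.
    It is finite because V is bounded, so it cancels and leaves c k times the integral of D equal to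
    0. *)
Lemma integral_invariant_pinched (mu : probability XT R) :
  mu (@phase_space R) = 1 ->
  invariant_measure (skew_product (@doubling R) (pinched_rotation k p c)) mu ->
  \int[mu]_q (dist_int (k%:~R * circle_val q.2))%:E = 0.
Proof.
move=> mu1 inv.
set F : XT -> XT := skew_product (@doubling R) (pinched_rotation k p c).
have mF : measurable_fun setT F := measurable_pinched_skew k p c.
have mX : measurable (@phase_space R) by apply: measurableX.
(* Invariance is stated within [phase_space]; as [mu] gives it full measure, the usual form with the
   image measure follows. *)
have muF A : measurable A -> pushforward mu F A = mu A.
  move=> mA; have mFA : measurable (F @^-1` A) by rewrite -[_ @^-1` _]setTI;
    exact: mF.
  rewrite -[RHS]inv// /pushforward setIC.
  rewrite (measureDI mu mFA mX) [X in X + _ = _](_ : _ = 0) ?add0e//.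
  apply/eqP; rewrite eq_le measure_ge0 andbT.
  apply: (@le_trans _ _ (mu (~` (@phase_space R)))).
    by rewrite le_measure ?inE//; [exact: measurableD|exact: measurableC].
  by rewrite probability_setC// mu1 subee.
pose V (q : XT) := (Defs.frac (k%:~R * circle_val q.2))%:E.
pose D (q : XT) := (dist_int (k%:~R * circle_val q.2))%:E.
have mky : measurable_fun setT (fun q : XT => k%:~R * circle_val q.2)%R.
  by apply: measurable_funM => //;
    exact: (measurableT_comp (@measurable_circle_val R)).
have mV : measurable_fun setT V.
  by apply/measurable_EFinP; exact: (measurableT_comp (@measurable_frac R)).
have mD : measurable_fun setT D.
  by apply/measurable_EFinP; exact: (measurableT_comp (@measurable_dist_int R)).
have V0 q : 0 <= V q by rewrite lee_fin;
  have /andP[] := frac_itv (k%:~R * circle_val q.2).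
have V1 q : V q <= 1 by rewrite lee_fin;
  have /andP[_ /ltW] := frac_itv (k%:~R * circle_val q.2).
have D0 q : 0 <= D q by rewrite lee_fin dist_int_ge0.
have ck0 : (0 < c * k%:~R)%R by rewrite mulr_gt0// ltr0z.
have VE q : V q = V (F q) + (c * k%:~R)%:E * D q.
  rewrite -EFinM -EFinD; congr EFin; apply/esym.
  exact: (frac_pinched_rotation p (ltW c_gt0) ck k_gt0).
have VF : \int[mu]_q V (F q) = \int[mu]_q V q.
  transitivity (\int[pushforward mu F]_q V q).
    by rewrite (ge0_integral_pushforward mF).
  by apply: eq_measure_integral => A mA _; exact: muF.
have mVF : measurable_fun setT (V \o F) := measurableT_comp mV mF.
have Vfin : \int[mu]_q V q \is a fin_num.
  rewrite ge0_fin_numE; last exact: integral_ge0.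
  apply: (@le_lt_trans _ _ (\int[mu]_q (cst 1 q))).
    exact: ge0_le_integral_nonmeasurable.
  by rewrite integral_cst// mul1e (le_lt_trans (probability_le1 _ _))// ltry.
have VD : \int[mu]_q V q = \int[mu]_q V q + (c * k%:~R)%:E * \int[mu]_q D q.
  rewrite -{2}VF -ge0_integralZl_EFin//; last exact: ltW.
  rewrite -ge0_integralD//.
  - by apply: eq_integral => q _; exact: VE.
  - by move=> q _; rewrite mule_ge0// lee_fin ltW.
  - exact: measurable_funeM.
have /eqP : (c * k%:~R)%:E * \int[mu]_q D q = 0.
  by rewrite -[LHS]add0e -(subee Vfin) addeAC -VD subee.
by rewrite mule_eq0 eqe gt_eqF//= => /eqP.
Qed.

(** The exact mean is 1 / 4. With s = 1 / (2 k), the integrand at t and at t + s sums to 1 / 2, so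
    twice the mean is at least (1 - s) / 2 >= 1 / 4; restricting t to [0, 1 - s] costs at most the
    factor 2. *)
Lemma integral_circle_lebesgue_dist_int :
  (8^-1)%:E <= \int[@lebesgue_X R]_q (dist_int (k%:~R * circle_val q.2))%:E.
Proof.
have msnd : measurable_fun setT (snd : XT -> circle R) := measurable_snd.
pose d (y : circle R) := (dist_int (k%:~R * circle_val y))%:E.
have md : measurable_fun setT d by apply/measurable_EFinP;
  exact: measurable_dist_int_circle.
have d0 y : 0 <= d y by rewrite lee_fin dist_int_ge0.
pose f (t : measurableTypeR R) := (dist_int (k%:~R * t))%:E.
have mf : measurable_fun [set: R] f.
  apply/measurable_EFinP; apply: (measurableT_comp (@measurable_dist_int R)).
  exact: measurable_funM.
have f0 t : 0 <= f t by rewrite lee_fin dist_int_ge0.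
have -> : \int[@lebesgue_X R]_q (dist_int (k%:~R * circle_val q.2))%:E =
    \int[m]_(t in `[0%R, 1%R]) f t.
  transitivity (\int[pushforward (@lebesgue_X R) (snd : XT -> circle R)]_y d y).
    by rewrite (ge0_integral_pushforward msnd).
  transitivity (\int[@circle_lebesgue R]_y d y).
    apply: eq_measure_integral => A mA _.
    transitivity (@lebesgue_X R (setT `*` A)).
      by congr (lebesgue_X _); apply/seteqP; split => -[u v] /=; [move=> ?;
        split | case].
    transitivity (uniform_prob (@ltr01 R) setT * @circle_lebesgue R A).
      exact: product_measure1E.
    by rewrite probability_setT mul1e.
  transitivity (\int[uniform_prob (@ltr01 R)]_t d (to_circle t)).
    exact: (ge0_integral_pushforward (@measurable_to_circle R)).
  rewrite (integral_uniform (@ltr01 R)) //;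
    last exact: (measurableT_comp md (@measurable_to_circle R)).
  rewrite subr0 invr1 mul1e; apply: eq_integral => t _.
  by rewrite /d /f /= dist_int_intfrac.
have kR : (1 <= k%:~R :> R)%R by rewrite ler1z.
pose s : R := ((2 * k%:~R)^-1)%R.
have s0 : (0 <= s)%R by rewrite invr_ge0 mulr_ge0// (le_trans ler01).
have s1 : (s <= 2^-1)%R.
  by rewrite lef_pV2 ?posrE ?ler_peMr// mulr_gt0// (lt_le_trans ltr01).
have ks : (k%:~R * s = 2^-1)%R.
  by rewrite /s invfM mulrCA divff ?mulr1// gt_eqF// (lt_le_trans ltr01).
set I := \int[m]_(t in _) f t.
have h1 : \int[m]_(t in `[0%R, (1 - s)%R]) f t <= I.
  apply: ge0_subset_integral => //; first exact: measurable_funTS.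
  by move=> t; rewrite /= !in_itv /=; lra.
have h2 : \int[m]_(t in `[0%R, (1 - s)%R]) f (t + s)%R <= I.
  have := @ge0_integral_affine R 1 s ltr01
    `[s, 1%R]%classic f (measurable_itv _).
  rewrite invr1 mul1e (_ : affine 1 s @^-1` _ = `[0%R, (1 - s)%R]%classic);
    last first.
    by apply/seteqP; split => t; rewrite /= !in_itv /= /affine mul1r; lra.
  under eq_integral do rewrite /affine mul1r.
  move=> ->//; last exact: measurable_funTS.
  apply: ge0_subset_integral => //; first exact: measurable_funTS.
  by move=> t; rewrite /= !in_itv /=; lra.
have h3 : ((1 - s) / 2)%:E <= I + I.
  apply: le_trans (leeD h1 h2).
  rewrite -ge0_integralD//; last 2 first.
  - exact: measurable_funTS.
  - apply: measurable_funTS; apply: (measurableT_comp mf).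
    exact: measurable_funD.
  rewrite (_ : ((1 - s) / 2)%:E =
    \int[m]_(t in `[0%R, (1 - s)%R]) (cst (2^-1)%:E t)).
    by apply: ge0_le_integral_nonmeasurable => t _;
      rewrite lee_fin ?invr_ge0// mulrDr ks dist_int_half; lra.
  rewrite integral_cst//= lebesgue_measure_itv/= lte_fin; case: ifPn => s1'.
    by rewrite -EFinB -EFinM subr0 mulrC.
  by exfalso; move: s1'; lra.
rewrite -(@lee_pmul2l _ 2%:E)//; apply: le_trans (le_trans h3 _).
  by rewrite -EFinM lee_fin; lra.
by rewrite mule_natl mule2n.
Qed.

End invariant_measures.

(** * Approximation by rationals and conclusion *)

Section approximation.
Context {R : realType}.
Implicit Types (theta gamma : R) (k : int).

(** Otherwise c0 would witness that gamma belongs to the set whose infimum is [lin_type theta].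
    Negative k reduce to positive ones because the distance to the nearest integer is even. *)
Lemma lin_type_gt theta gamma (c0 : R) : (gamma%:E < lin_type theta)%E ->
  0 < c0 ->
  exists2 k : int, 0 < k & dist_int (k%:~R * theta) < c0 * k%:~R `^ (- gamma).
Proof.
move=> gt c0_gt0; apply: contrapT => noapprox.
move: gt; rewrite ltNge => /negP; apply; apply: ereal_inf_lbound.
exists gamma => //; exists c0 => // k k0; rewrite leNgt; apply/negP => kl.
apply: noapprox; exists `|k|; first by rewrite normr_gt0.
have [k1|k1] := leP 0 k;
  first by rewrite ger0_norm// -[in ltRHS](@ger0_norm R k%:~R) ?ler0z.
by rewrite ltr0_norm// intrN mulNr dist_intN -(@ltr0_norm R k%:~R) ?ltrz0.
Qed.

Lemma good_approximation theta gamma (j : nat) : 1 < gamma ->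
  (gamma%:E < lin_type theta)%E ->
  exists a : R * int * int, let: (delta, k, p) := a in
  [/\ 0 < delta <= j.+1%:R^-1, 0 < k, `|theta - p%:~R / k%:~R| <= delta / 2,
      delta * k%:~R <= 1 & delta `^ (gamma - 1)^-1 <= k%:~R^-1].
Proof.
move=> gamma1 gt; have j0 : (0 : R) < j.+1%:R by [].
have j1 : (j.+1%:R^-1 : R) <= 1 by rewrite invf_le1// ler1n.
(* The factor 1 / (j + 1) forces delta to 0; the factor 1 / 2 reserves half of delta for the
   pinching. *)
have [//|k k0 kapprox] := @lin_type_gt theta gamma (j.+1%:R^-1 / 2) gt.
set x : R := k%:~R in kapprox.
have x1 : 1 <= x by rewrite ler1z.
have x0 : 0 < x := lt_le_trans ltr01 x1.
have [p papprox] := dist_int_lt_ex kapprox.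
have xg0 : 0 < x `^ (- gamma) by rewrite powR_gt0.
have xgx : x `^ (- gamma) <= x^-1.
  rewrite -powR_inv1 ?(ltW x0)// ler_powR//; lra.
have xg1 : x `^ (- gamma) <= 1 by rewrite (le_trans xgx)// invf_le1.
pose delta := j.+1%:R^-1 * x `^ (- gamma).
have delta_ge0 : 0 <= delta by rewrite mulr_ge0 ?invr_ge0 ?(ltW j0) ?(ltW xg0).
have dx : delta <= x `^ (- gamma) by rewrite ler_piMl// ltW.
exists (delta, k, p); split => //.
- by rewrite mulr_gt0 ?invr_gt0//= ler_piMr// invr_ge0 ltW.
(* Dividing by k gains a further factor 1 / k, which is simply given up. *)
- have -> : theta - p%:~R / k%:~R = (x * theta - p%:~R) / x by field;
    rewrite gt_eqF.
  rewrite normrM normfV (gtr0_norm x0) ler_pdivrMr//.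
  apply: le_trans (ltW papprox) _.
  rewrite /delta mulrAC -[leLHS]mulr1 ler_wpM2l//
    mulr_ge0 ?invr_ge0// mulr_ge0 ?invr_ge0 ?(ltW j0) ?(ltW xg0).
- apply: le_trans (ler_wpM2r (ltW x0) (le_trans dx xgx)) _.
  by rewrite mulVf// gt_eqF.
(* The resulting power of k is -gamma / (gamma - 1), which is below -1. *)
- have e0 : 0 < (gamma - 1)^-1 by rewrite invr_gt0 subr_gt0.
  apply: (@le_trans _ _ ((x `^ (- gamma)) `^ (gamma - 1)^-1)).
    by rewrite ge0_ler_powR ?nnegrE ?(ltW e0) ?(ltW xg0).
  rewrite -powRrM -/x -(powR_inv1 (ltW x0)) ler_powR//.
  rewrite mulNr lerN2 ler_pdivlMr ?subr_gt0//; lra.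
Qed.

End approximation.

Section distance.
Context {R : realType}.
Local Notation XT := (measurableTypeR R * circle R)%type.

Lemma one_norm_pinched (k p : int) (c : R) (mu : probability XT R) :
  0 < c -> c * `|k%:~R| <= 2^-1 -> 0 < k -> mu (@phase_space R) = 1%E ->
  invariant_measure (skew_product doubling (pinched_rotation k p c)) mu ->
  ((8^-1 / k%:~R)%:E <= one_norm (csub (charge_of_finite_measure lebesgue_X)
                            (charge_of_finite_measure mu)))%E.
Proof.
move=> c0 ck k0 mu1 inv; set x : R := k%:~R.
have x1 : 1 <= x by rewrite ler1z.
have x0 : 0 < x := lt_le_trans ltr01 x1.
pose d (y : circle R) := dist_int (x * circle_val y).
have md : measurable_fun setT d := measurable_dist_int_circle k.
have d0 y : 0 <= d y := dist_int_ge0 _.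
pose g (y : circle R) := x^-1 * d y.
have mg : measurable_fun setT g by exact: measurable_funM.
have g0 y : 0 <= g y by rewrite mulr_ge0 ?invr_ge0 ?(ltW x0).
have mdX : measurable_fun setT (fun q : XT => (d q.2)%:E).
  by apply/measurable_EFinP; exact: (measurableT_comp md measurable_snd).
have d0X (q : XT) : (0 <= (d q.2)%:E)%E by rewrite lee_fin.
apply: (@le_trans _ _ (\int[@lebesgue_X R]_q (g q.2)%:E)%E).
  rewrite (_ : (\int[_]_q _ = x^-1%:E * \int[@lebesgue_X R]_q (d q.2)%:E)%E);
    last first.
    by rewrite -ge0_integralZl_EFin// invr_ge0 ltW.
  rewrite mulrC EFinM lee_wpmul2l ?lee_fin ?invr_ge0 ?(ltW x0)//.
  exact: integral_circle_lebesgue_dist_int.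
apply: one_norm_ge => //.
- move=> y; rewrite /g; have := dist_int_le_half (x * circle_val y);
    rewrite -/(d y) => dh.
  have x1' : x^-1 <= 1 by rewrite invf_le1.
  apply: (@le_trans _ _ (1 * d y)); first by rewrite ler_wpM2r.
  by rewrite mul1r (le_trans dh)//; lra.
- move=> y z; rewrite /g -mulrBr normrM (gtr0_norm (_ : 0 < x^-1)) ?invr_gt0//.
  rewrite ler_pdivrMl//; apply: le_trans (dist_intB _ _) _.
  by rewrite -mulrBr (le_trans (dist_intMz _ _))// gtr0_norm.
- have := integral_invariant_pinched c0 ck k0 mu1 inv.
  rewrite -/x => intd.
  (* A nonnegative function with integral 0 vanishes almost everywhere, so {g > 0} is null for [mu]
     as [one_norm_ge] demands. *)
  have [N [mN N0 hN]] : ae_eq mu setT (fun q : XT => (d q.2)%:E) (cst 0%E).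
    apply/ae_eq_integral_abs => //; rewrite -[RHS]intd.
    by apply: eq_integral => q _; rewrite gee0_abs.
  apply/eqP; rewrite eq_le measure_ge0 andbT -[leRHS]N0.
  have mZ : measurable [set y | 0 < g y].
    rewrite (_ : [set _ | _] = setT `&` g @^-1` `]0%R, +oo[%classic);
      first exact: mg.
    by rewrite setTI; apply/seteqP; split => y; rewrite /= in_itv /= andbT.
  rewrite le_measure ?inE//; first exact: measurableX.
  move=> q [_ /= gq]; apply: hN => /= /(_ I) [] dq.
  by move: gq; rewrite /g dq mulr0 ltxx.
Qed.

End distance.

Theorem theorem3 (R : realType) (theta : R)
  (theta_irr : irrational theta)
  (theta_dioph : (lin_type theta < +oo)%E)
  (theta_type : (2%:E < lin_type theta)%E)
  (gamma : R) (gamma_gt1 : 1 < gamma)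
  (gamma_lt : (gamma%:E < lin_type theta)%E) :
  exists (delta : nat -> R) (Ghat : nat -> R -> circle R -> circle R),
    [/\ [/\ forall j, 0 < delta j,
            delta j @[j --> \oo] --> 0 &
            forall j, measurable_fun (@phase_space R) (skew_product doubling (Ghat j))],
        uniform_condA (fun=> doubling) Ghat,
        forall j, condD1 doubling doubling (delta j),
        forall j, condD2 (rotation_skew theta) (Ghat j) (delta j) &
        forall j (mu : probability (measurableTypeR R * circle R)%type R),
          mu (@phase_space R) = 1%E ->
          invariant_measure (skew_product doubling (Ghat j)) mu ->
          pushforward mu fst `<< lebesgue_measure ->
          ((9^-1 * delta j `^ (gamma - 1)^-1)%:E <=
             one_norm (csub (charge_of_finite_measure lebesgue_X)
                            (charge_of_finite_measure mu)))%E].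
Proof.
have /choice[a aP] := fun j =>
  @good_approximation R theta gamma j gamma_gt1 gamma_lt.
pose delta j := (a j).1.1; pose k j := (a j).1.2; pose p j := (a j).2.
pose c j := delta j / 2.
have {}aP j : [/\ 0 < delta j <= j.+1%:R^-1, 0 < k j,
    `|theta - (p j)%:~R / (k j)%:~R| <= delta j / 2,
    delta j * (k j)%:~R <= 1 & delta j `^ (gamma - 1)^-1 <= (k j)%:~R^-1].
  by have := aP j; rewrite /delta /k /p; case: (a j) => [[? ?] ?].
have delta0 j : 0 < delta j by have [/andP[]] := aP j.
have k0 j : 0 < k j by have [] := aP j.
have c0 j : 0 < c j by rewrite divr_gt0.
have ck j : c j * `|(k j)%:~R| <= 2^-1.
  by have [_ _ _ dk _] := aP j;
    rewrite gtr0_norm ?ltr0z// mulrAC ler_pdivrMr//; lra.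
exists delta, (fun j => pinched_rotation (k j) (p j) (c j)); split.
- split => // [|j]; last first.
    exact: measurable_funTS (measurable_pinched_skew _ _ _).
  apply: (@squeeze_cvgr _ _ _ _ (fun=> 0) (fun j => j.+1%:R^-1)).
  + by near=> j; have [/andP[/ltW -> ->]] := aP j.
  + exact: cvg_cst.
  + exact: cvg_harmonic.
(* The branches are affine, so C_h = 0; the contraction requirement reads 1 / 2 times 3 / 2 = 3 / 4
   < 1. *)
- exists 2^-1, 0, (3 / 2), 1, 2, 1; split => //; [lra|lra|] => j.
  split; first exact: doubling_condA1.
    exact: pinched_rotation_A2 (ltW (c0 j)) (ck j).
  exact: pinched_rotation_A3.
- by move=> j; apply: condD1_refl; exact: ltW.
- move=> j; apply: pinched_rotation_D2; first exact: ltW.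
  by have [_ _ h _ _] := aP j; rewrite /c; lra.
- move=> j mu mu1 inv _; have [_ _ _ _ dk] := aP j.
  apply: le_trans (one_norm_pinched (c0 j) (ck j) (k0 j) mu1 inv).
  have kj : 0 < ((k j)%:~R : R)^-1 by rewrite invr_gt0 ltr0z.
  rewrite lee_fin; apply: le_trans (ler_wpM2l _ dk) _;
    first by rewrite invr_ge0.
  (* The bound obtained has 1 / 8 in place of 1 / 9. *)
  by rewrite ler_wpM2r ?(ltW kj)// lef_pV2 ?posrE//; lra.
Unshelve. all: by end_near. Qed.
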